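(* Fix a positive integer $n$. Then for every ordinal $\varepsilon$ with $\mathrm{cf}(\varepsilon)<\aleph_n$ and every admissible choice of the club $C_\varepsilon$, the set $d_n(\mathcal B_n(\varepsilon)[C_\varepsilon])=\{d_n b: b\in\mathcal B_n(\varepsilon)[C_\varepsilon]\}$ is a basis for the inverse system $\mathbf d_n\mathbf P_n(\varepsilon)$. In particular, every such $\mathbf d_n\mathbf P_n(\varepsilon)$ is free.
   Context: Cofinalities: a successor ordinal is regarded as having cofinality smaller than every infinite cardinal (e.g. $1$). A $C$-sequence is fixed: for each ordinal $\beta$ under consideration, $C_\beta$ is a closed cofinal subset of $\beta$ of order type $\mathrm{cf}(\beta)$ (so $C_0=\varnothing$, $C_{\alpha+1}=\{\alpha\}$), such that for limit $\beta$ with increasing enumeration $\langle\eta_i:i<\mathrm{cf}(\beta)\rangle$ of $C_\beta$ one has $\mathrm{cf}(\eta_i)=\mathrm{cf}(i)$, and $C_\kappa=\kappa$ for infinite regular cardinals $\kappa$; $C_\varepsilon$ is any club of this kind in $\varepsilon$. Compound clubs: if $C_{\vec\gamma}$ is defined (for a finite tuple $\vec\gamma$) and $\beta\in C_{\vec\gamma}$, let $\alpha=\mathrm{otp}(C_{\vec\gamma}\cap\beta)$, $\pi:C_{\vec\gamma}\cap\beta\to\alpha$ the order isomorphism, and $C_{\beta\vec\gamma}=\pi^{-1}(C_\alpha)$ (here $\beta\vec\gamma$ is the tuple $\beta$ followed by $\vec\gamma$). Let $C^{\vec\gamma}(\alpha)=\min(C_{\vec\gamma}\setminus(\alpha+1))$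 when defined. A tuple $(\alpha_0,\dots,\alpha_m)$ is internal to $C_\beta$ iff $\alpha_m\in C_\beta$, $\alpha_i\in C_{\alpha_{i+1}\cdots\alpha_m\beta}$ for all $i<m$, and $\mathrm{cf}(\alpha_0)\le\mathrm{cf}(\alpha_i)<\mathrm{cf}(\alpha_j)<\mathrm{cf}(\beta)$ for $0<i<j\le m$. $P_n(A)$, for a set $A$ of ordinals, is the free abelian group on generators $\langle\vec\alpha\rangle$, $\vec\alpha\in[A]^{n+1}$ (increasing tuples); $d_n\langle\vec\alpha\rangle=\sum_{i=0}^n(-1)^i\langle\vec\alpha^i\rangle$ with $\vec\alpha^i$ omitting the $i$-th coordinate. $\langle\vec\alpha,\vec\beta\rangle$ denotes the generator of the concatenation. $\mathcal B_n(\varepsilon)[C_\varepsilon]$ is the set of generators $\langle\vec\alpha,\vec\beta\rangle$ of $P_n(\varepsilon)$ such that $\vec\alpha\in[\varepsilon]^{i+1}$ for some $i<n$, $\vec\beta\in[\varepsilon]^{n-i}$ is internal to $C_\varepsilon$, and $C^{\vec\beta^0\varepsilon}(\alpha_i)=\beta_0$ (where $\vec\beta^0\varepsilon$ is $(\beta_1,\dots,\beta_{n-i-1},\varepsilon)$). $\mathbf d_n\mathbf P_n(\varepsilon)$ is the inverse system indexed by $\varepsilon$ whose term at $\alpha$ is the subgroup $d_n(P_n([\alpha,\varepsilon)))$ of $P_{n-1}([\alpha,\varepsilon))$, bonding maps being inclusions. A set $\mathcal B\subseteq\bigcup_\alpha X_\alpha$ is a basis of an inverse system $(X_\alpha,x_{\alpha\beta},\varepsilon)$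 if every $x\in X_\alpha$ has a unique decomposition $x=\sum_{i<k}a_ix_{\alpha\beta_i}(b_i)$ with $\alpha\le\beta_i$, distinct $b_i\in X_{\beta_i}\cap\mathcal B$, nonzero integers $a_i$ (here each $d_n\langle\vec\gamma\rangle$ is regarded as an element of the term at $\gamma_0$); the system is free if it has a basis. *)

(* Defs.v *)
From HB Require Import structures.
From mathcomp Require Import all_boot all_order all_algebra.
From mathcomp Require Import boolp classical_sets functions cardinality wochoice.
From mathcomp.multinomials Require Import freeg.

Set Implicit Arguments.
Unset Strict Implicit.
Unset Printing Implicit Defensive.

Import Order.TTheory GRing.Theory.

Local Open Scope classical_set_scope.
Local Open Scope order_scope.

(* Ordinals are the points of an arbitrary well-ordered type T: the point x    *)
(* stands for the order type of its initial segment below x.  All notions      *)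
(* attached to x (cofinality, order types of subsets of x, being the n-th      *)
(* aleph, clubs in x) only involve points <= x, so they do not depend on T.    *)
Section Ordinals.
Context {d : Order.disp_t} {T : orderType d}.
Implicit Types (x y a b k l : T) (A D : set T) (e : T -> T) (C : T -> set T).

Definition below b : set T := [set x | x < b].

Definition least (P : set T) x := P x /\ forall y, P y -> x <= y.

Definition limit_ord b :=
  (exists x, x < b) /\ forall x, x < b -> exists2 y, x < y & y < b.

Definition enumerates e a A :=
  {in below a &, forall i j, i < j -> e i < e j} /\ e @` below a = A.

Definition is_otp A a := exists e, enumerates e a A.

Definition cofinal_in b A :=
  A `<=` below b /\ forall x, x < b -> exists2 y, A y & x <= y.

Definition closed_in b A := forall a, a < b -> (exists x, x < a) ->
  (forall x, x < a -> exists y, [/\ A y, x < y & y < a]) -> A a.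

Definition is_cf b : set T :=
  least [set a | exists2 A, cofinal_in b A & is_otp A a].

(* The default value b of xget is never used when T is well ordered. *)
Definition cf b : T := xget b (is_cf b).

Definition regular k := limit_ord k /\ cf k = k.

Fixpoint is_aleph (n : nat) : set T :=
  match n with
  | 0 => least [set k | ~ finite_set (below k)]
  | m.+1 => least [set k | exists2 l, is_aleph m l
                                    & ~ (below k #<= below l)%card]
  end.

(* The n-th aleph need not be a point of T, in which case all points of T are  *)
(* smaller than it.                                                            *)
Definition lt_aleph x (n : nat) := forall k, is_aleph n k -> x < k.

Definition admissible_club b D :=
  [/\ cofinal_in b D, closed_in b D, is_otp D (cf b) &
      limit_ord b -> forall e, enumerates e (cf b) D ->
        forall i, i < cf b -> cf (e i) = cf i].

Definition C_sequence C :=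
  (forall b, admissible_club b (C b)) /\
  (forall k, regular k -> C k = below k).

(* If e enumerates D `&` below b in type a, then e is the inverse of the       *)
(* order isomorphism D `&` below b -> a, hence the image of C a by e is the    *)
(* preimage of C a by that isomorphism.                                        *)
Definition compound_step C D b : set T :=
  [set x | exists a e, enumerates e a (D `&` below b) /\ (e @` C a) x].

(* C_(s, eps), where D stands for C_eps. *)
Fixpoint compound C D (s : seq T) : set T :=
  if s is b :: s' then compound_step C (compound C D s') b else D.

Definition is_next D x y := least [set z | D z /\ x < z] y.

Definition internal C eps D (s : seq T) :=
  [/\ s != [::],
      forall i, (i < size s)%N ->
        compound C D (drop i.+1 s) (nth eps s i) &
      forall i j, (0 < i)%N -> (i < j)%N -> (j < size s)%N ->
        [/\ cf (nth eps s 0) <= cf (nth eps s i),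
            cf (nth eps s i) < cf (nth eps s j) &
            cf (nth eps s j) < cf eps]].

(* The increasing n-tuples of elements of A, i.e. [A]^n. *)
Definition incr_tuple (n : nat) A (s : seq T) :=
  [/\ size s = n, sorted <%O s & {in s, forall x, A x}].

Definition B_gen C (n : nat) eps D : set (seq T) :=
  [set s | exists (i : nat) (u v : seq T),
    [/\ s = u ++ v /\ incr_tuple n.+1 (below eps) s,
        (i < n)%N, size u = i.+1 /\ size v = (n - i)%N,
        internal C eps D v &
        is_next (compound C D (behead v)) (last eps u) (head eps v)]].

End Ordinals.

Section Chains.
Context {d : Order.disp_t} {T : orderType d}.
Local Open Scope ring_scope.

Definition P_gr (n : nat) (A : set T) : set {freeg (seq T) / int} :=
  [set x | forall s, s \in dom x -> incr_tuple n.+1 A s].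

Definition boundary_gen (s : seq T) : {freeg (seq T) / int} :=
  \sum_(i < size s) << (-1) ^+ i *g take i s ++ drop i.+1 s >>.

(* On chains of (n+1)-tuples this is d_n. *)
Definition boundary (x : {freeg (seq T) / int}) : {freeg (seq T) / int} :=
  fglift boundary_gen x.

Lemma boundary_is_additive : additive boundary.
Proof. exact: lift_is_additive. Qed.

HB.instance Definition _ :=
  GRing.isAdditive.Build _ _ boundary boundary_is_additive.

Definition final_interval (a eps : T) : set T :=
  [set x | (a <= x)%O /\ (x < eps)%O].

Definition dP_pred (n : nat) (eps a : T) : {pred {freeg (seq T) / int}} :=
  fun x => `[< (boundary @` P_gr n (final_interval a eps)) x >].

Lemma dP_pred_zmod n eps a : zmod_closed (dP_pred n eps a).
Proof.
split; first by apply/asboolP; exists 0; rewrite ?raddf0 // => s; rewrite dom0.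
move=> _ _ /asboolP[x Px <-] /asboolP[y Py <-]; apply/asboolP.
exists (x - y); last by rewrite raddfB.
by move=> s /domB; rewrite mem_cat => /orP[/Px|/Py].
Qed.

HB.instance Definition _ n eps a :=
  GRing.isZmodClosed.Build _ (dP_pred n eps a) (dP_pred_zmod n eps a).

Record dP_term (n : nat) (eps a : T) :=
  DPTerm { dP_val :> {freeg (seq T) / int}; _ : dP_val \in dP_pred n eps a }.

HB.instance Definition _ n eps a := [isSub for @dP_val n eps a].
HB.instance Definition _ n eps a := [Choice of dP_term n eps a by <:].
HB.instance Definition _ n eps a :=
  [SubChoice_isSubZmodule of dP_term n eps a by <:].

End Chains.

Section InverseSystems.
Context {d : Order.disp_t} {I : porderType d}.

Record invsys := InvSys {
  term : I -> zmodType;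
  bond : forall a b : I, a <= b -> {additive term b -> term a};
  bond_id : forall a (h : a <= a) (x : term a), bond h x = x;
  bond_comp : forall a b c (hab : a <= b) (hbc : b <= c) (hac : a <= c)
    (x : term c), bond hac x = bond hab (bond hbc x) }.

Variable S : invsys.

(* Disjoint union of the terms. *)
Definition total_space := {b : I & term S b}.

Definition above (a : I) := {p : total_space | a <= tag p}.

Definition bond_above (a : I) (p : above a) : term S a :=
  bond S (valP p) (tagged (val p)).

(* A formal integer combination c of pairs (b_i in X_(beta_i)) is a finite set *)
(* of distinct pairs with nonzero coefficients, up to reordering.              *)
Definition eval_above (a : I) (c : {freeg (above a) / int}) : term S a :=
  (\sum_(p <- dom c) bond_above p *~ coeff p c)%R.

Definition is_basis (B : set total_space) :=
  forall (a : I) (x : term S a),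
    exists! c : {freeg (above a) / int},
      (forall p, p \in dom c -> B (val p)) /\ x = eval_above c.

Definition is_free := exists B : set total_space, is_basis B.

End InverseSystems.
Arguments invsys {d} I.

Section DP.
Context {d : Order.disp_t} {T : orderType d}.

Definition seg (eps : T) : Type := {a : T | a < eps}.

HB.instance Definition _ eps := SubChoice.on (seg eps).
HB.instance Definition _ eps := [SubChoice_isSubPOrder of seg eps by <: with d].

Variables (n : nat) (eps : T).

Lemma dP_sub (a b : seg eps) (x : dP_term n eps (val b)) :
  a <= b -> dP_val x \in dP_pred n eps (val a).
Proof.
case: x => x /= /asboolP[y Py <-] ab; apply/asboolP; exists y => //.
move=> s /Py[sz so Ps]; split=> // z /Ps[bz ze]; split=> //.
exact: le_trans bz.
Qed.

Definition dP_incl (a b : seg eps) (h : a <= b) (x : dP_term n eps (val b)) :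
  dP_term n eps (val a) := DPTerm (dP_sub x h).

Lemma dP_incl_additive (a b : seg eps) (h : a <= b) : additive (dP_incl h).
Proof. by move=> x y; apply: val_inj. Qed.

HB.instance Definition _ (a b : seg eps) (h : a <= b) :=
  GRing.isAdditive.Build _ _ (dP_incl h) (dP_incl_additive h).

Lemma dP_incl_id (a : seg eps) (h : a <= a) (x : dP_term n eps (val a)) :
  dP_incl h x = x.
Proof. exact: val_inj. Qed.

Lemma dP_incl_comp (a b c : seg eps) (hab : a <= b) (hbc : b <= c)
    (hac : a <= c) (x : dP_term n eps (val c)) :
  dP_incl hac x = dP_incl hab (dP_incl hbc x).
Proof. exact: val_inj. Qed.

Definition dP : invsys (seg eps) :=
  @InvSys _ (seg eps) (fun a => dP_term n eps (val a))
    (fun a b h => dP_incl h) dP_incl_id dP_incl_comp.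

(* The boundary of the generator s is placed in the term at s_0. *)
Definition dB (C : T -> set T) (D : set T) : set (total_space dP) :=
  [set p | exists s : seq T, [/\ B_gen C n eps D s,
    ohead s = Some (val (tag p)) & dP_val (tagged p) = boundary << s >>%R]].

End DP.
Arguments dP {d T} n eps.
Arguments dB {d T} n eps C D.

(* Main.v *)
Require Import Defs.
From HB Require Import structures.
From mathcomp Require Import all_boot all_order all_algebra.
From mathcomp Require Import boolp classical_sets functions cardinality wochoice.
From mathcomp.multinomials Require Import freeg.

(** The generators of [B_n(eps)[D]] ending in [g] are of two kinds: those of the
    form [(u, g)] with [g] the successor in [D] of the last entry of [u], and,
    when [g] is a limit point of [D], those of the form [(t, g)] with [t] in
    [B_(n-1)(g)] for the compound club of [g].  One therefore argues by induction
    on [n] and, for fixed [n], by transfinite induction along [D], comparing the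
    cycles on [[a, g]] with those supported strictly below [g].

    At a limit point [g], the coefficient of [g] in a cycle on [[a, g]] is a cycle
    of one dimension less on [[a, g)], where the induction on [n] applies: there
    [cf g < cf eps], so that the bound on the cofinality drops by one aleph.  At a
    successor [g] of [g0] in [D], a cycle is the boundary of a cone with vertex
    [g], and [d d (z, g0, g) = 0] exchanges the cones [(z, g)] with [z] below [g0]
    for cones [(z, g0)], up to boundaries of generators [(w, g0, g)]. *)

Set Implicit Arguments.
Unset Strict Implicit.
Unset Printing Implicit Defensive.

Import Order.TTheory GRing.Theory.

(** * Enumerations and order types in a well-order *)

Section WellOrder.
Local Open Scope classical_set_scope.
Local Open Scope order_scope.
Context {d : Order.disp_t} {T : orderType d}.
Hypothesis T_wo : well_order (@Order.le d T).
Implicit Types (x y a b i j k l : T) (A D R : set T) (e f h : T -> T).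

Lemma ex_least A : A !=set0 -> exists x, least A x.
Proof.
move=> [x0 Ax0]; have [|z [[zA lbz] _]] := T_wo (A := fun x => `[< A x >]).
  by exists x0; apply/asboolP.
exists z; split; first exact/asboolP.
by move=> y Ay; apply: lbz; apply/asboolP.
Qed.

Lemma lt_ind (P : T -> Prop) :
  (forall x, (forall y, y < x -> P y) -> P x) -> forall x, P x.
Proof.
move=> IH x; apply: contrapT => nPx.
have [|z [nPz zmin]] := @ex_least (~` P); first by exists x.
by apply: nPz; apply: IH => y yz; apply: contrapT => /zmin; rewrite leNgt yz.
Qed.

Lemma lt_wf : well_founded (fun x y : T => x < y).
Proof. by apply: lt_ind => x IH; constructor. Qed.

Lemma enum_lt e a A i j : enumerates e a A -> i < a -> j < a -> i < j -> e i < e j.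
Proof. by case=> mono _ ia ja; apply: mono; exact: mem_set. Qed.

Lemma enum_mem e a A i : enumerates e a A -> i < a -> A (e i).
Proof. by case=> _ <- ia; exists i. Qed.

Lemma enum_inv e a A x : enumerates e a A -> A x -> exists2 i, i < a & e i = x.
Proof. by case=> _ <- [i ia <-]; exists i. Qed.

Lemma enum_intro e a A :
  (forall i j, i < a -> j < a -> i < j -> e i < e j) ->
  (forall i, i < a -> A (e i)) ->
  (forall x, A x -> exists2 i, i < a & e i = x) -> enumerates e a A.
Proof.
move=> mono mem inv; split.
  by move=> i j /set_mem ia /set_mem ja; apply: mono.
by apply/seteqP; split=> [_ [i ia <-]|x /inv[i ia <-]]; [exact: mem|exists i].
Qed.

Lemma enum_le e a A i j : enumerates e a A -> i < a -> j < a ->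
  (e i <= e j) = (i <= j).
Proof.
move=> en ia ja; case: (ltgtP i j) => [ij|ji|->]; last by rewrite lexx.
  exact/ltW/(enum_lt en).
by apply/negbTE; rewrite -ltNge; apply: enum_lt en _ _ ji.
Qed.

Lemma enum_ltE e a A i j : enumerates e a A -> i < a -> j < a ->
  (e i < e j) = (i < j).
Proof. by move=> en ia ja; rewrite !ltNge (enum_le en). Qed.

Lemma enum_id a : enumerates id a (below a).
Proof. by apply: enum_intro => // x xa; exists x. Qed.

(** At the first disagreement, the smaller of the two values would already be taken by the other
    enumeration at an earlier index, where both agree. The types [a] and [a'] may differ, so that
    uniqueness of the order type can be deduced from this. *)
Lemma enum_agree e e' a a' A i : enumerates e a A -> enumerates e' a' A ->
  i < a -> i < a' -> e i = e' i.
Proof.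
move=> en en'; elim/lt_ind: i => i IH ia ia'.
have half f f' b b' : enumerates f b A -> enumerates f' b' A -> i < b -> i < b' ->
    (forall j, j < i -> j < b -> j < b' -> f j = f' j) -> f' i <= f i.
  move=> nf nf' ib ib' fE; rewrite leNgt; apply/negP => lt.
  have [j jb' fj] := enum_inv nf' (enum_mem nf ib).
  have ji : j < i by rewrite -(enum_ltE nf' jb' ib') fj.
  have := enum_lt nf (lt_trans ji ib) ib ji.
  by rewrite fE ?(lt_trans ji ib) // fj ltxx.
apply: le_anti; apply/andP; split.
  apply: half en' en _ _ _ => // j ji ja' ja; exact/esym/IH.
exact: half en en' _ _ _.
Qed.

Lemma enum_uniq e e' a a' A : enumerates e a A -> enumerates e' a' A -> a = a'.
Proof.
have half f f' b b' : enumerates f b A -> enumerates f' b' A -> b' <= b.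
  move=> nf nf'; rewrite leNgt; apply/negP => bb'.
  have [i ib fi] := enum_inv nf (enum_mem nf' bb').
  have ib' := lt_trans ib bb'.
  have := enum_lt nf' ib' bb' ib.
  by rewrite -fi (enum_agree nf nf') ?ltxx.
by move=> en en'; apply: le_anti; rewrite (half _ _ _ _ en' en) (half _ _ _ _ en en').
Qed.

Lemma enum_comp e h a b A D : enumerates e a A -> enumerates h b D ->
  D `<=` below a -> enumerates (e \o h) b (e @` D).
Proof.
move=> en nh Da; have ha i : i < b -> h i < a by move=> ib; apply/Da/(enum_mem nh).
apply: enum_intro => [i j ib jb ij|i ib|_ [y Dy <-]] /=.
- by rewrite (enum_ltE en) ?ha // (enum_ltE nh).
- by exists (h i) => //; apply: enum_mem nh ib.
- by have [i ib <-] := enum_inv nh Dy; exists i.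
Qed.

Lemma enum_below e a A i : enumerates e a A -> i < a ->
  enumerates e i (A `&` below (e i)).
Proof.
move=> en ia; apply: enum_intro => [j k ji ki|j ji|x [Ax xi]].
- by apply: (enum_lt en); apply: lt_trans ia.
- have ja := lt_trans ji ia.
  by split; [exact: enum_mem en _|rewrite /below /= (enum_ltE en)].
- have [j ja ej] := enum_inv en Ax; exists j => //.
  by rewrite -(enum_ltE en) // ej.
Qed.

(** The Mostowski collapse of [A], by well-founded recursion and extended to all points of [T]. The
    default [x] of [xget] is never reached, since [x] itself bounds the earlier values. *)
Definition collapse A : T -> T :=
  Fix lt_wf (fun _ => T) (fun x (rec : forall z, z < x -> T) =>
    xget x (least [set y | forall z (zx : z < x), A z -> rec z zx < y])).

Lemma collapseE A x : collapse A x =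
  xget x (least [set y | forall z, z < x -> A z -> collapse A z < y]).
Proof.
rewrite /collapse Fix_eq // => y f g fg; congr xget; congr least.
by apply/seteqP; split=> z /= zP t ty At; [rewrite -fg|rewrite fg]; apply: zP.
Qed.

Lemma collapseP A x : collapse A x <= x /\
  least [set y | forall z, z < x -> A z -> collapse A z < y] (collapse A x).
Proof.
elim/lt_ind: x => x IH.
set S := [set y | _].
have Sx : S x by move=> z zx _; have [cz _] := IH z zx; apply: le_lt_trans zx.
have [z lz] : exists z, least S z by apply: ex_least; exists x.
have ls : least S (collapse A x) by rewrite collapseE; apply: (xgetI x) lz.
by split=> //; apply: ls.2.
Qed.

Lemma collapse_lt A x y : A x -> x < y -> collapse A x < collapse A y.
Proof. by move=> Ax xy; have [_ [cy _]] := collapseP A y; apply: cy. Qed.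

Lemma collapse_initial A x y : A x -> y < collapse A x ->
  exists2 z, A z & collapse A z = y.
Proof.
elim/lt_ind: x => x IH Ax yx.
have [_ [_ cmin]] := collapseP A x.
have [z zx [Az yz]] : exists2 z, z < x & A z /\ y <= collapse A z.
  apply: contrapT => no; have /cmin : forall z, z < x -> A z -> collapse A z < y.
    by move=> z zx Az; rewrite ltNge; apply/negP => yz; apply: no; exists z.
  by rewrite leNgt yx.
move: yz; rewrite le_eqVlt => /orP[/eqP->|yz]; first by exists z.
exact: IH yz.
Qed.

(** The image of [A] under the collapse is an initial segment. The order type is the least point
    that it misses, and [l] is missed because the collapse never exceeds the identity. *)
Lemma ex_otp A l : A `<=` below l -> exists2 a, a <= l & is_otp A a.
Proof.
move=> Al; set I := collapse A @` A.
have nIl : ~ I l.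
  by move=> [x Ax cx]; have [] := collapseP A x; rewrite cx leNgt (Al _ Ax).
have [a [nIa amin]] : exists a, least (~` I) a by apply: ex_least; exists l.
exists a; first exact: amin.
have Ilt x : A x -> collapse A x < a.
  move=> Ax; rewrite ltNge; apply/negP; rewrite le_eqVlt => /orP[/eqP ax|].
    by apply: nIa; exists x.
  by move=> /(collapse_initial Ax)[z Az cz]; apply: nIa; exists z.
have Iin y : y < a -> I y.
  by move=> ya; apply: contrapT => /amin; rewrite leNgt ya.
pose e y := xget y [set x | A x /\ collapse A x = y].
have eP y : y < a -> A (e y) /\ collapse A (e y) = y.
  by move=> /Iin[x Ax cx]; apply: (@xgetPex _ y [set x | A x /\ collapse A x = y]); exists x.
have cinj x y : A x -> A y -> collapse A x < collapse A y -> x < y.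
  move=> Ax Ay; rewrite !ltNge; apply: contraNN; rewrite le_eqVlt.
  by move=> /orP[/eqP->//|/(collapse_lt Ay)/ltW].
exists e; apply: enum_intro => [i j /eP[Ai ci] /eP[Aj cj] ij|i /eP[]//|x Ax].
  by apply: cinj; rewrite ?ci ?cj.
exists (collapse A x); first exact: Ilt.
have [Ae ce] := eP _ (Ilt _ Ax); apply: le_anti.
by rewrite !leNgt; apply/andP; split; apply/negP;
  [move=> /(collapse_lt Ax)|move=> /(collapse_lt Ae)]; rewrite ce ltxx.
Qed.

(** * Cofinality *)

Lemma cfP b : is_cf b (cf b).
Proof.
have [a ha] : exists a, is_cf b a.
  by apply: ex_least; exists b, (below b); [split=> // x; exists x|exists id; apply: enum_id].
exact: (xgetI b ha).
Qed.

Lemma cf_le b : cf b <= b.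
Proof.
by apply: (cfP b).2; exists (below b); [split=> // x; exists x|exists id; apply: enum_id].
Qed.

(* A cofinal map becomes increasing, and stays cofinal, once restricted to the
   points at which it exceeds all its previous values. *)
Lemma cf_le_map b l f : (forall i, i < l -> f i < b) ->
  (forall x, x < b -> exists2 i, i < l & x <= f i) -> cf b <= l.
Proof.
move=> fb fcof.
pose R : set T := [set i | i < l /\ forall j, j < i -> f j < f i].
have Rl : R `<=` below l by move=> i [].
have [a al [e en]] := ex_otp Rl.
apply: le_trans al; apply: (cfP b).2; exists (f @` R).
  split=> [_ [i [il _] <-]|x /fcof[i0 i0l xi0]]; first exact: fb.
  have [i [[il xi] imin]] : exists i, least [set i | i < l /\ x <= f i] i.
    by apply: ex_least; exists i0.
  exists (f i) => //; exists i => //; split=> // j ji.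
  rewrite ltNge; apply/negP => fij; have : i <= j.
    by apply: imin; split; [exact: lt_trans il|exact: le_trans fij].
  by rewrite leNgt ji.
have eR i : i < a -> R (e i) by exact: enum_mem en.
exists (f \o e); apply: enum_intro => [i j ia ja ij|i ia|_ [y Ry <-]] /=.
- by have [_] := eR _ ja; apply; exact: (enum_lt en).
- by exists (e i) => //; apply: eR.
- by have [i ia <-] := enum_inv en Ry; exists i.
Qed.

Lemma cf_enum b : exists A e, cofinal_in b A /\ enumerates e (cf b) A.
Proof. by have [[A cA [e en]] _] := cfP b; exists A, e. Qed.

(** * Limit points, successors and compound clubs *)

Definition limit_point D x :=
  (exists2 y, D y & y < x) /\
  forall y, y < x -> exists z, [/\ D z, y < z & z < x].

Lemma not_limitP b : ~ limit_ord b -> (exists x, x < b) ->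
  exists2 m, m < b & forall x, x < b -> x <= m.
Proof.
move=> nl ne; apply: contrapT => no; apply: nl; split=> // x xb.
apply: contrapT => no'; apply: no; exists x => // y yb.
by rewrite leNgt; apply/negP => xy; apply: no'; exists y.
Qed.

Lemma cf_gt0 b x : x < b -> exists y, y < cf b.
Proof.
move=> xb; have [A [e [[_ cA] en]]] := cf_enum b.
by have [y /(enum_inv en)[i]] := cA _ xb; exists i.
Qed.

Lemma cf_succ_le b m l x : m < b -> (forall x, x < b -> x <= m) -> x < l ->
  cf b <= l.
Proof.
move=> mb mmax xl; apply: (@cf_le_map _ _ (fun=> m)) => // y /mmax.
by exists x.
Qed.

(** Both cofinalities are the ordinal 1; comparing two successors avoids having to name that point
    of [T]. *)
Lemma cf_succ b m b' m' : m < b -> (forall x, x < b -> x <= m) ->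
  m' < b' -> (forall x, x < b' -> x <= m') -> cf b = cf b'.
Proof.
move=> mb mM mb' mM'; have [y yc] := cf_gt0 mb; have [y' yc'] := cf_gt0 mb'.
by apply: le_anti; rewrite (cf_succ_le mb mM yc') (cf_succ_le mb' mM' yc).
Qed.

Lemma otp_cf_nonlimit b D x y : ~ limit_ord b -> is_otp D (cf b) ->
  D `<=` below b -> D x -> D y -> x = y.
Proof.
move=> nl [e en] Db Dx Dy.
have [m mb mM] := not_limitP nl (ex_intro _ x (Db _ Dx)).
have half i j : i < cf b -> j < cf b -> i <= j.
  move=> ic jc; rewrite leNgt; apply/negP => ji.
  by have := cf_succ_le mb mM ji; rewrite leNgt ic.
have [i ic <-] := enum_inv en Dx; have [j jc <-] := enum_inv en Dy.
by congr e; apply: le_anti; rewrite !half.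
Qed.

Lemma limit_point_limit D x : limit_point D x -> limit_ord x.
Proof.
move=> [[y _ yx] lp]; split; first by exists y.
by move=> z /lp[t [_ zt tx]]; exists t.
Qed.

Lemma limit_point_in_limit b D x : D `<=` below b -> is_otp D (cf b) ->
  D x -> limit_point D x -> limit_ord b.
Proof.
move=> Db oD Dx [[y Dy yx] _]; apply: contrapT => nl.
by have := otp_cf_nonlimit nl oD Db Dx Dy => xy; rewrite xy ltxx in yx.
Qed.

(** If [x] has index [i] in [D], admissibility gives [cf x = cf i <= i < cf b]. This drop is what
    bounds the nesting of limit points. *)
Lemma club_cf_lt b D x : limit_ord b -> admissible_club b D -> D x -> cf x < cf b.
Proof.
move=> lb [cD clD [e en] cfD] Dx; have [i ic <-] := enum_inv en Dx.
by rewrite (cfD lb e en _ ic); apply: le_lt_trans ic; apply: cf_le.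
Qed.

Lemma compound_stepE C D e a b : enumerates e a (D `&` below b) ->
  C a `<=` below a -> compound_step C D b = e @` C a.
Proof.
move=> en Ca; apply/seteqP; split=> [x [a' [e' [en' [y Cy <-]]]]|x Cx]; last by exists a, e.
have aa := enum_uniq en' en; rewrite aa in en' Cy; exists y => //.
by apply: (enum_agree en en'); apply: Ca.
Qed.

(** Write [x = e i] with [e] the enumeration of [D]. The compound club is the image of [C i] under
    [e], and [cf x = cf i] by admissibility of [D]. Everything is then transported from [C i];
    closedness of [D] ensures that limits of the image are again values of [e]. *)
Lemma admissible_compound C b D x : C_sequence C -> admissible_club b D ->
  D x -> limit_point D x ->
  [/\ limit_ord b, limit_ord x & admissible_club x (compound_step C D x)].
Proof.
move=> [CC _] [[Db cD] clD oD cfD] Dx lx.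
have lb := limit_point_in_limit Db oD Dx lx.
have limx := limit_point_limit lx.
split=> //; have [e en] := oD; have [i ic ex] := enum_inv en Dx.
have enx := enum_below en ic; rewrite ex in enx.
have [[Ci cCi] clCi [h nh] cfCi] := CC i.
have li : limit_ord i.
  split.
    have [[y Dy yx] _] := lx.
    by have [j ji _] := enum_inv enx (conj Dy yx); exists j.
  move=> j ji; have jc := lt_trans ji ic; have ejx : e j < x by rewrite -ex (enum_ltE en).
  have [_ /(_ _ ejx)[z [Dz ez zx]]] := lx.
  have [k ki kz] := enum_inv enx (conj Dz zx); exists k => //.
  by rewrite -(enum_ltE en) ?kz // (lt_trans ki).
have cfx : cf x = cf i by rewrite -ex; apply: cfD en _ ic.
have stE := compound_stepE enx Ci.
have enS := enum_comp enx nh Ci.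
have sub j : C i j -> j < cf b by move=> /Ci ji; apply: lt_trans ic.
rewrite stE; split.
- split=> [_ [j Cj <-]|y yx].
    by have /= ji := Ci _ Cj; rewrite /below /= -ex (enum_ltE en) //; apply: sub.
  have [_ /(_ _ yx)[z [Dz yz zx]]] := lx.
  have [j ji ej] := enum_inv enx (conj Dz zx).
  have [k Ck jk] := cCi _ ji; exists (e k); first by exists k.
  by apply: le_trans (ltW yz) _; rewrite -ej (enum_le en) ?(sub _ Ck) ?(lt_trans ji).
- move=> a ax a0 alim.
  have ab : a < b by apply: lt_trans ax _; apply: Db.
  have Da : D a.
    apply: clD => // y /alim[_ [[k Ck <-] yk ka]]; exists (e k); split=> //.
    exact/(enum_mem en)/sub.
  have [j ji ej] := enum_inv enx (conj Da ax).
  have jc := lt_trans ji ic.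
  exists j => //; apply: clCi => //.
    have [y ya] := a0; have [_ [[k Ck <-] _ ka]] := alim _ ya.
    by exists k; rewrite -(enum_ltE en) ?(sub _ Ck) // ej.
  move=> k kj; have kc := lt_trans kj jc.
  have /alim[_ [[k' Ck' <-] kk ka]] : e k < a by rewrite -ej (enum_ltE en).
  have kc' := sub _ Ck'.
  by exists k'; split=> //; rewrite -(enum_ltE en) ?ej.
- by rewrite cfx; exists (e \o h).
- move=> _ e' ne' k kc; rewrite cfx in ne' kc.
  rewrite (enum_agree ne' enS) //=.
  have Chk := enum_mem nh kc.
  by rewrite (cfD lb e en) ?sub //; apply: cfCi.
Qed.

(** * Infinite cofinalities and alephs *)

Lemma limit_cf_infinite b : limit_ord b -> ~ finite_set (below (cf b)).
Proof.
move=> [[x0 x0b] lb] fin; have [A [e [[Ab cA] en]]] := cf_enum b.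
have [s sE] : exists s : seq T, below (cf b) = [set` s] by apply/finite_seqP.
have ub : forall s' : seq T, {subset s' <= s} ->
    exists2 y, y < b & forall i, i \in s' -> e i < y.
  elim=> [_|i s' IH sub]; first by exists x0.
  have [|y yb ymax] := IH; first by move=> j js; apply: sub; rewrite inE js orbT.
  have eib : e i < b.
    apply/Ab/(enum_mem en); suff : below (cf b) i by [].
    by rewrite sE /=; apply: sub; rewrite mem_head.
  have [|z mz zb] := lb (Order.max y (e i)); first by rewrite gt_max yb eib.
  move: mz; rewrite gt_max => /andP[yz eiz].
  by exists z => // j; rewrite inE => /orP[/eqP->//|/ymax jy]; apply: lt_trans yz.
have [//|y yb ymax] := ub s; have [z /(enum_inv en)[i ic <-]] := cA _ yb.
by rewrite leNgt ymax //; have : below (cf b) i by []; rewrite sE.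
Qed.

(** Suppose that the [n]-th aleph [k] is at most [cf x], hence below [cf b]. An injection of [cf b]
    into [k] would yield a cofinal map from [k] to [b]. So [cf b] has cardinality above that of [k],
    and the next aleph exists and is at most [cf b]. *)
Lemma lt_aleph_descend b x n : lt_aleph (cf b) n.+1 -> cf x < cf b ->
  lt_aleph (cf x) n.
Proof.
move=> cfb xb k ak; rewrite ltNge; apply/negP => kx.
have kb := le_lt_trans kx xb.
have ncard : ~ (below (cf b) #<= below k)%card.
  move=> /card_leP[f].
  have [A [e [[Ab cA] en]]] := cf_enum b.
  have [y yc] : exists y, y < cf b by exists k.
  (* [g] inverts the injection on its image and takes the value [y] elsewhere, so that it always
     lands below [cf b]. *)
  pose g i := xget y [set j | exists2 u : below (cf b), val u = j & val (f u) = i].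
  have gP i : g i < cf b.
    by rewrite /g; case: xgetP => [j _ [u <- _]|_ //]; have := valP u; rewrite inE.
  have : cf b <= k.
    apply: (@cf_le_map _ _ (e \o g)) => [i ik|z /cA[t At zt]] /=.
      exact/Ab/(enum_mem en).
    have [j jc ej] := enum_inv en At.
    pose u : below (cf b) := SigSub (mem_set (jc : below (cf b) j)).
    exists (val (f u)); first by have := valP (f u); rewrite inE.
    suff -> : g (val (f u)) = j by rewrite ej.
    rewrite /g; case: xgetP => [j' _ [u' <- /val_inj fu]|no].
      by rewrite (@inj _ _ _ f u' u _ _ fu) ?inE.
    by case: (no j); exists u.
  by rewrite leNgt kb.
have [k' k'P] : exists k', is_aleph n.+1 k'.
  by apply: ex_least; exists (cf b), k.
have := cfb k' k'P; rewrite ltNge => /negP; apply.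
by case: k'P => _; apply; exists k.
Qed.

Lemma limit_not_lt_aleph0 b : limit_ord b -> ~ lt_aleph (cf b) 0.
Proof.
move=> /limit_cf_infinite inf small.
have [k kP] : exists k, least [set k : T | ~ finite_set (below k)] k.
  by apply: ex_least; exists (cf b).
by have := small k kP; rewrite ltNge => /negP; apply; apply: kP.2.
Qed.

(** * Existence of admissible clubs and C-sequences *)

(* The supremum of the successors of the previous values: this makes a cofinal
   sequence continuous, and makes its values at successors successors. *)
Definition sup_succ f i : T := xget (f i) (least [set y | forall j, j < i -> f j < y]).

Lemma sup_succP f i : (forall j, j < i -> f j < f i) ->
  least [set y | forall j, j < i -> f j < y] (sup_succ f i).
Proof. by move=> fi; apply: xgetPex; apply: ex_least; exists (f i). Qed.

(** At a limit [b], the club is enumerated by [e = sup_succ f] for an increasing cofinal [f]; the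
    two sequences interleave, [e i <= f i < e j] for [i < j]. At any other [b], a set witnessing the
    cofinality has at most one point and closure is vacuous. *)
Lemma ex_admissible_club b : exists D, admissible_club b D.
Proof.
have [A [f [[Ab cA] en]]] := cf_enum b.
have [lb|nl] := pselect (limit_ord b); last first.
  exists A; split=> //; last by exists f.
  move=> a ab [x0 x0a] alim; have [y [Ay _ ya]] := alim _ x0a.
  have [m mb mM] := not_limitP nl (ex_intro _ a ab).
  have [m' Am' mm'] := cA _ mb.
  have ym : y = m' by apply: otp_cf_nonlimit nl _ Ab Ay Am'; exists f.
  by have := lt_le_trans ya (mM _ ab); rewrite ltNge ym mm'.
have cfnomax j : j < cf b -> exists2 k, j < k & k < cf b.
  move=> jc; have [_ /(_ _ (Ab _ (enum_mem en jc)))[y fy /cA[z Az yz]]] := lb.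
  have [k kc fk] := enum_inv en Az; exists k => //.
  by rewrite -(enum_ltE en) // fk; apply: lt_le_trans yz.
pose e := sup_succ f.
have eP i : i < cf b -> least [set y | forall j, j < i -> f j < y] (e i).
  by move=> ic; apply: sup_succP => j ji; apply: (enum_lt en) => //; apply: lt_trans ic.
have ef i : i < cf b -> e i <= f i.
  move=> ic; apply: (eP _ ic).2 => j ji.
  by apply: (enum_lt en) => //; apply: lt_trans ic.
have fe i j : i < j -> j < cf b -> f i < e j.
  by move=> ij jc; apply: (eP _ jc).1.
have elt i j : i < cf b -> j < cf b -> i < j -> e i < e j.
  by move=> ic jc ij; apply: le_lt_trans (ef _ ic) (fe _ _ ij jc).
pose D := e @` below (cf b).
have ne : enumerates e (cf b) D.
  by split=> // i j /set_mem ic /set_mem jc; apply: elt.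
have cof x : x < b -> exists2 i, i < cf b & x < e i.
  move=> /cA[y Ay xy]; have [j jc fj] := enum_inv en Ay.
  have [k jk kc] := cfnomax _ jc; exists k => //.
  by apply: le_lt_trans xy _; rewrite -fj; apply: fe.
have eb i : i < cf b -> e i < b.
  by move=> ic; apply: le_lt_trans (ef _ ic) _; apply/Ab/(enum_mem en).
exists D; split.
- split=> [_ [i ic <-]|x /cof[i ic xi]]; first exact: eb.
  by exists (e i); [exists i|apply: ltW].
(* Take [i] least with [a <= e i]. If [a < e i], some [j < i] has [e j < a <= f j]; a point [e k] of
   the club between [e j] and [a] would satisfy [j < k], hence [f j < e k < a]. *)
- move=> a ab _ alim; have [i0 i0c ai0] := cof _ ab.
  have [i [[ic ai] imin]] : exists i, least [set i | i < cf b /\ a <= e i] i.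
    by apply: ex_least; exists i0; split=> //; apply: ltW.
  move: ai; rewrite le_eqVlt => /orP[/eqP->|ai]; first by exists i.
  exfalso; have [j ji aj] : exists2 j, j < i & a <= f j.
    apply: contrapT => no; have /(eP _ ic).2 : forall j, j < i -> f j < a.
      by move=> j ji; rewrite ltNge; apply/negP => aj; apply: no; exists j.
    by rewrite leNgt ai.
  have jc := lt_trans ji ic.
  have eja : e j < a.
    rewrite ltNge; apply/negP => aej; have := imin j (conj jc aej).
    by rewrite leNgt ji.
  have [_ [[k kc <-] jk ka]] := alim _ eja.
  rewrite (enum_ltE ne) // in jk.
  by have := lt_trans (fe _ _ jk kc) ka; rewrite ltNge aj.
- by exists e.
- move=> _ e' ne' i ic; rewrite (enum_agree ne' ne) //.
  (* Three cases: [e] fixes the least point, takes successor values at successors, and is continuous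
     at limits. *)
  have [[j0 j0i]|i0] := pselect (exists j, j < i); last first.
    suff -> : e i = i by [].
    have no x : ~ x < i by move=> xi; apply: i0; exists x.
    have ei : e i <= i by apply: (eP _ ic).2 => j /no.
    by apply: le_anti; rewrite ei leNgt; apply/negP => /no.
  have [li|nli] := pselect (limit_ord i); last first.
    have [m mi mM] := not_limitP nli (ex_intro _ j0 j0i).
    have fmi : f m < e i by apply: fe.
    apply: (@cf_succ _ (f m) _ m) => // x xi; rewrite leNgt; apply/negP => mx.
    have /(eP _ ic).2 : forall j, j < i -> f j < x.
      move=> j ji; apply: le_lt_trans mx; rewrite (enum_le en) ?mM //.
        exact: lt_trans ic.
      exact: lt_trans ic.
    by rewrite leNgt xi.
  have ltc j : j < i -> j < cf b by move=> ji; apply: lt_trans ic.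
  have cofi x : x < e i -> exists2 j, j < i & x < e j.
    move=> xi; have [j ji xj] : exists2 j, j < i & x <= f j.
      apply: contrapT => no; have /(eP _ ic).2 : forall j, j < i -> f j < x.
        by move=> j ji; rewrite ltNge; apply/negP => xj; apply: no; exists j.
      by rewrite leNgt xi.
    have [_ /(_ _ ji)[k jk ki]] := li; exists k => //.
    by apply: le_lt_trans xj _; apply: fe jk (ltc _ ki).
  apply: le_anti; apply/andP; split.
    have [B [h [[Bi cB] nh]]] := cf_enum i.
    apply: (@cf_le_map _ _ (e \o h)) => [k kc|x /cofi[j ji xj]] /=.
      by have hk := Bi _ (enum_mem nh kc); apply: elt => //; apply: ltc.
    have [y By jy] := cB _ ji; have [k kc hk] := enum_inv nh By; exists k => //.
    apply: le_trans (ltW xj) _; rewrite (enum_le ne) ?ltc ?hk //.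
    exact: (Bi _ By).
  have [B [h [[Bi cB] nh]]] := cf_enum (e i).
  pose g k := xget i (least [set j | h k <= e j]).
  have gP k : k < cf (e i) -> g k < i /\ h k <= e (g k).
    move=> kc; have [j ji hj] := cofi _ (Bi _ (enum_mem nh kc)).
    have : least [set j | h k <= e j] (g k).
      by apply: xgetPex; apply: ex_least; exists j; apply: ltW.
    by case=> gk gmin; split=> //; apply: le_lt_trans ji; apply: gmin; apply: ltW.
  apply: (@cf_le_map _ _ g) => [k /gP[]//|j ji].
  have [y By jy] := cB _ (elt _ _ (ltc _ ji) ic ji).
  have [k kc hk] := enum_inv nh By; exists k => //; have [gi gk] := gP _ kc.
  by rewrite -(enum_le ne) ?ltc //; apply: le_trans gk; rewrite hk.
Qed.

(** At a regular [k] the whole segment [below k] is admissible, enumerated by the identity;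
    elsewhere any admissible club is chosen. *)
Lemma ex_C_sequence : exists C : T -> set T, C_sequence C.
Proof.
have /choice[C CP] : forall b, exists D, admissible_club b D /\ (regular b -> D = below b).
  move=> b; have [rb|nr] := pselect (regular b); last first.
    by have [D aD] := ex_admissible_club b; exists D.
  exists (below b); split=> //; have [lb cfb] := rb; split=> //.
  - by split=> // x; exists x.
  - by rewrite cfb; exists id; apply: enum_id.
  - by move=> _ e; rewrite cfb => en i ib; rewrite (enum_agree en (enum_id b)).
by exists C; split=> [b|k]; [have [] := CP b|have [] := CP k].
Qed.

(** * Inductive description of the generators *)

(* The generators, without the cofinality conditions of [internal]: these hold
   automatically when [g] is a limit point, and the tuples they exclude at
   successors are already of the form [Bset_next]. *)
Inductive Bset C : set T -> seq T -> Prop :=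
| Bset_next D u x g : is_next D x g -> Bset C D (rcons (rcons u x) g)
| Bset_limit D t g : D g -> limit_point D g ->
    Bset C (compound_step C D g) t -> Bset C D (rcons t g).

Lemma compound_rcons C D s g :
  compound C D (rcons s g) = compound C (compound_step C D g) s.
Proof. by elim: s => //= x s ->. Qed.

(** Let [a] be the least strict upper bound of the points of [D] below [g]. If these have no
    maximum, then [a] is a limit of them; [a < g] would put [a] in [D] by closedness, hence strictly
    below itself. *)
Lemma closed_cases b D g : closed_in b D -> D `<=` below b -> D g ->
  [\/ limit_point D g, forall y, D y -> g <= y |
      exists g0, [/\ D g0, g0 < g & forall y, D y -> y < g -> y <= g0]].
Proof.
move=> clD Db Dg.
have [[y0 Dy0 y0g]|no] := pselect (exists2 y, D y & y < g); last first.
  by apply: Or32 => y Dy; rewrite leNgt; apply/negP => yg; apply: no; exists y.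
have [?|nomax] := pselect (exists g0, [/\ D g0, g0 < g & forall y, D y -> y < g -> y <= g0]).
  exact: Or33.
apply: Or31; split; first by exists y0.
have [a [aub amin]] : exists a, least [set a | forall z, D z -> z < g -> z < a] a.
  by apply: ex_least; exists g.
have alim x : x < a -> exists z, [/\ D z, x < z & z < g].
  move=> xa; have [z [Dz zg xz]] : exists z, [/\ D z, z < g & x <= z].
    apply: contrapT => no; have /amin : forall z, D z -> z < g -> z < x.
      by move=> z Dz zg; rewrite ltNge; apply/negP => xz; apply: no; exists z.
    by rewrite leNgt xa.
  apply: contrapT => no; apply: nomax; exists z; split=> // t Dt tg.
  rewrite leNgt; apply/negP => zt; apply: no; exists t; split=> //.
  exact: le_lt_trans zt.
have : a <= g by apply: amin.
rewrite le_eqVlt => /orP[/eqP ag|ag].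
  by move=> y yg; apply: alim; rewrite ag.
have Da : D a.
  apply: clD; first exact: lt_trans ag (Db _ Dg).
    by exists y0; apply: aub.
  by move=> x /alim[z [Dz xz zg]]; exists z; split=> //; apply: aub.
by have := aub _ Da ag; rewrite ltxx.
Qed.

Lemma compound_step_sub C D g : C_sequence C ->
  compound_step C D g `<=` D `&` below g.
Proof.
move=> [CC _] _ [a [e [en [y Cy <-]]]]; apply: (enum_mem en).
by have [[Ca _] _ _ _] := CC a; apply: Ca.
Qed.

(** The part of [D] below [g] has a last point [g0], so its order type [a] is a successor, and [C a]
    consists of the predecessor of [a], the index of [g0]. *)
Lemma compound_step_succ C D g0 g x : C_sequence C -> D g0 -> g0 < g ->
  (forall y, D y -> y < g -> y <= g0) -> compound_step C D g x -> x = g0.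
Proof.
move=> [CC _] Dg0 g0g g0max [a [e [en [y Cy <-]]]].
have [m ma em] := enum_inv en (conj Dg0 g0g).
have [[Ca cCa] _ oC _] := CC a.
have mM z : z < a -> z <= m.
  move=> za; rewrite -(enum_le en) // em; have [] := enum_mem en za.
  exact: g0max.
have nl : ~ limit_ord a.
  by move=> [_ /(_ _ ma)[z mz /mM]]; rewrite leNgt mz.
have [m' Cm' mm'] := cCa _ ma.
have m'm : m' = m by apply: le_anti; rewrite mm' mM //; apply: Ca.
by rewrite -em; congr e; rewrite -m'm; apply: otp_cf_nonlimit nl oC Ca Cy Cm'.
Qed.

(** Read [v] from its last entry [g], replacing [D] by the compound club at [g]. That club is empty
    when [g] is the first point of [D]. When [g] succeeds [g0] in [D], it contains no point other
    than [g0] and the club after it is empty, so the whole tuple ends in [(g0, g)] and falls under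
    [Bset_next]. *)
Lemma internal_Bset C x0 v b D u x : C_sequence C -> admissible_club b D ->
  v != [::] ->
  (forall i : nat, (i < size v)%N -> compound C D (drop i.+1 v) (nth x0 v i)) ->
  is_next (compound C D (behead v)) x (head x0 v) ->
  Bset C D (rcons u x ++ v).
Proof.
move=> CC; elim/last_ind: v b D => [//|v g IH] b D aD _ hv hn.
have Dg : D g.
  by have := hv (size v); rewrite size_rcons drop_oversize ?size_rcons //
    nth_rcons ltnn eqxx; apply.
have [v0|vN0] := eqVneq v [::].
  by move: hn; rewrite v0 cats1; apply: Bset_next.
have hv' (i : nat) : (i < size v)%N ->
    compound C (compound_step C D g) (drop i.+1 v) (nth x0 v i).
  move=> iv; have := hv i; rewrite size_rcons drop_rcons // compound_rcons nth_rcons iv.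
  by apply; apply: ltnW.
have hn' : is_next (compound C (compound_step C D g) (behead v)) x (head x0 v).
  by move: hn; case: (v) vN0 => //= y v' _; rewrite compound_rcons.
rewrite -rcons_cat; have [[Db cD] clD oD cfD] := aD.
have [lg|gmin|[g0 [Dg0 g0g g0max]]] := closed_cases clD Db Dg.
- apply: Bset_limit => //; have [_ _ aS] := admissible_compound CC aD Dg lg.
  exact: IH aS vN0 hv' hn'.
- case/lastP: v vN0 hv' {IH hv hn hn'} => // v y _ /(_ (size v)).
  rewrite size_rcons drop_oversize ?size_rcons // nth_rcons ltnn eqxx => /(_ (ltnSn _)).
  by move=> /(compound_step_sub CC)[/gmin]; rewrite leNgt /below /= => /negbTE->.
- case/lastP: v vN0 hv' {IH hv hn hn'} => // v y _ hv.
  have /(compound_step_succ CC Dg0 g0g g0max) yg0 : compound_step C D g y.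
    by have := hv (size v); rewrite size_rcons drop_oversize ?size_rcons //
    nth_rcons ltnn eqxx; apply.
  have v0 : v = [::].
    case/lastP: v hv => // v z hv; exfalso.
    have := hv (size v); rewrite !size_rcons drop_rcons ?size_rcons //.
    rewrite !nth_rcons !size_rcons ltnSn ltnn eqxx => /(_ (ltnW (ltnSn _))).
    rewrite drop_oversize ?size_rcons //= => /(compound_step_sub CC)[zS].
    by rewrite yg0 (compound_step_succ CC Dg0 g0g g0max zS) /below /= ltxx.
  rewrite v0 yg0 cats1; apply: Bset_next; split=> // z [Dz g0z].
  by rewrite leNgt; apply/negP => /(g0max _ Dz); rewrite leNgt g0z.
Qed.

Lemma Bset_internal C D s b : C_sequence C -> Bset C D s -> admissible_club b D ->
  exists u x v, [/\ s = rcons u x ++ v, internal C b D v &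
    is_next (compound C D (behead v)) x (head b v)].
Proof.
move=> CC Bs.
(* The statement is strengthened for induction: the default [x0] is arbitrary because the ambient
   point changes from [b] to [g], and the chain of cofinalities includes [b]. At a nonlimit [b] the
   tuple [v] has one entry, so [internal] imposes no cofinality condition. *)
suff: admissible_club b D -> exists u x v, [/\ s = rcons u x ++ v, v != [::],
    forall (x0 : T) (i : nat), (i < size v)%N -> compound C D (drop i.+1 v) (nth x0 v i),
    forall x0, is_next (compound C D (behead v)) x (head x0 v) &
    if `[< limit_ord b >] then sorted (fun y z => cf y < cf z) (rcons v b)
    else size v == 1%N].
  move=> + aD => /(_ aD)[u [x [v [-> vN0 hv hn]]]]; case: asboolP => lb so.
    exists u, x, v; split=> //; split=> // [|i j i0 ij jv]; first exact: hv.
    have lt (k l : nat) : (k < l)%N -> (l <= size v)%N ->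
        cf (nth b (rcons v b) k) < cf (nth b (rcons v b) l).
      move=> kl lv; apply: (sorted_ltn_nth _ _ so) => //; rewrite ?inE ?size_rcons //.
      - by move=> ? ? ?; apply: lt_trans.
      - by rewrite ltnS (leq_trans (ltnW kl)).
    have iv := ltn_trans ij jv.
    split; [apply/ltW; have := lt 0 i i0|have := lt i j ij|have := lt j (size v) jv];
      rewrite !nth_rcons ?ltnn ?eqxx ?(ltn_trans i0 iv) ?iv ?jv; apply=> //; exact: ltnW.
  exists u, x, v; split=> //; split=> // [|i j i0 ij]; first exact: hv.
  rewrite (eqP so) ltnS leqn0.
  by move=> /eqP j0; rewrite j0 in ij.
elim: Bs b => {D s} [D u x g ng b aD|D t g Dg lg Bt IH b aD].
  exists u, x, [:: g]; rewrite cats1; split=> // [x0 [|//] _|].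
    by have [[]] := ng.
  by case: asboolP => //= lb; rewrite andbT; apply: club_cf_lt lb aD _; have [[]] := ng.
have [lb limg aS] := admissible_compound CC aD Dg lg.
have [u [x [v [-> vN0 hv hn]]]] := IH _ aS; rewrite (asboolT limg) => so.
exists u, x, (rcons v g); rewrite rcons_cat; split=> //.
- by case: (v).
- move=> x0 i; rewrite size_rcons ltnS leq_eqVlt => /orP[/eqP->|iv].
    by rewrite drop_oversize ?size_rcons // nth_rcons ltnn eqxx.
  by rewrite drop_rcons // compound_rcons nth_rcons iv; apply: hv.
- by move=> x0; have := hn x0; case: (v) vN0 => //= y v' _; rewrite compound_rcons.
- rewrite (asboolT lb); case: (v) vN0 so => //= y v' _ so.
  by rewrite rcons_path so last_rcons /=; apply: club_cf_lt lb aD Dg.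
Qed.

Lemma B_genP C n b D s : C_sequence C -> admissible_club b D ->
  B_gen C n b D s <-> incr_tuple n.+1 (below b) s /\ Bset C D s.
Proof.
move=> CC aD; split.
  move=> [i [u [v [[-> sb] ltin [su sv] [vN0 hv _] hn]]]]; split=> //.
  case/lastP: u su hn {sb} => // u x _; rewrite last_rcons => hn.
  exact: internal_Bset CC aD vN0 hv hn.
move=> [sb Bs]; have [u [x [v [sE iv nv]]]] := Bset_internal CC Bs aD.
have [+ _ _] := sb; rewrite sE size_cat size_rcons => szE.
have v0 : (0 < size v)%N by have [+ _ _] := iv; case: (v).
have lt : (size u < n)%N.
  by rewrite -ltnS -szE addSn ltnS -{1}[size u]addn0 ltn_add2l.
exists (size u), (rcons u x), v; rewrite last_rcons -sE size_rcons; split=> //.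
split=> //; rewrite addSn in szE; case: szE => <-.
by rewrite addKn.
Qed.

(** * Depth of nested limit points *)

(* Limit points can be nested at most n - 1 times. *)
Fixpoint nested_club C n b D : Prop :=
  if n is m.+1 then
    [/\ cofinal_in b D, closed_in b D &
        forall g, D g -> limit_point D g -> nested_club C m g (compound_step C D g)]
  else False.

(** Each limit point costs one aleph, and at 0 a contradiction arises because limits have infinite
    cofinality. Only the starting [b] may be a nonlimit, which is why [0 < n] is offered as an
    alternative. *)
Lemma admissible_nested_club C n b D : C_sequence C -> admissible_club b D ->
  lt_aleph (cf b) n -> (0 < n)%N \/ limit_ord b -> nested_club C n b D.
Proof.
move=> CC; elim: n b D => [|n IH] b D aD small n0.
  by case: n0 => // /limit_not_lt_aleph0.
have [cD clD _ _] := aD; split=> // g Dg lg.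
have [lb limg aS] := admissible_compound CC aD Dg lg.
by apply: IH => //; [apply: lt_aleph_descend small _; apply: club_cf_lt lb aD Dg|right].
Qed.

End WellOrder.

(** * Supports and linear extensions in free abelian groups *)

Section Supports.
Local Open Scope ring_scope.
Context {K : choiceType}.
Implicit Types (S : set K) (x y : {freeg K / int}) (s : K).

Definition supp S x := forall s, s \in dom x -> S s.

Lemma supp0 S : supp S 0.
Proof. by move=> s; rewrite dom0. Qed.

Lemma suppD S x y : supp S x -> supp S y -> supp S (x + y).
Proof. by move=> hx hy s /domD_subset; rewrite mem_cat => /orP[/hx|/hy]. Qed.

Lemma suppN S x : supp S x -> supp S (- x).
Proof. by move=> hx s; rewrite domN => /hx. Qed.

Lemma suppB S x y : supp S x -> supp S y -> supp S (x - y).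
Proof. by move=> hx hy; apply: suppD => //; apply: suppN. Qed.

Lemma suppMz S x (k : int) : supp S x -> supp S (x *~ k).
Proof.
move=> hx s; rewrite mem_dom raddfMz /= => h; apply: hx; rewrite mem_dom.
by apply: contra h => /eqP->; rewrite mul0rz.
Qed.

Lemma suppU S k s : S s -> supp S << k *g s >>.
Proof.
move=> Ss t; have [->|k0] := eqVneq k 0; first by rewrite freegU0 dom0.
by rewrite domU // inE => /eqP->.
Qed.

Lemma supp_sub S S' x : (forall s, S s -> S' s) -> supp S x -> supp S' x.
Proof. by move=> sub hx s /hx/sub. Qed.

Lemma supp_false S x : (forall s, ~ S s) -> supp S x -> x = 0.
Proof.
move=> nS hx; apply/eqP; rewrite -dom_eq0; case E: (dom x) => [//|s l].
by case: (nS s); apply: hx; rewrite E mem_head.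
Qed.

(** Reduces an additive statement about a chain to single generators while remembering that they lie
    in [S]. *)
Lemma supp_ind S (P : {freeg K / int} -> Prop) : P 0 ->
  (forall k s x, S s -> P x -> P (<< k *g s >> + x)) ->
  forall x, supp S x -> P x.
Proof.
move=> P0 PD x hx; rewrite -(freeg_sumE x); rewrite /supp in hx.
elim: (dom x) hx => [|s l IH] hx; first by rewrite big_nil.
rewrite big_cons; apply: PD; first by apply: hx; rewrite mem_head.
by apply: IH => t tl; apply: hx; rewrite inE tl orbT.
Qed.

Lemma supp_split S S1 S2 x : supp S x -> (forall s, S s -> S1 s \/ S2 s) ->
  exists x1 x2, [/\ x = x1 + x2, supp S1 x1 & supp S2 x2].
Proof.
move=> hx hS; move: x hx; apply: supp_ind => [|k s x /hS Ss [x1 [x2 [-> h1 h2]]]].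
  by exists 0, 0; rewrite addr0; split=> //; apply: supp0.
case: Ss => Ss.
  by exists (<< k *g s >> + x1), x2; rewrite addrA; split=> //; apply: suppD => //; apply: suppU.
by exists x1, (<< k *g s >> + x2); rewrite addrCA; split=> //; apply: suppD => //; apply: suppU.
Qed.

End Supports.

Section Linear.
Local Open Scope ring_scope.
Context {K L : choiceType} (f : K -> {freeg L / int}).

Definition freeg_ext (x : {freeg K / int}) : {freeg L / int} := fglift f x.

Lemma freeg_ext_additive : additive freeg_ext.
Proof. exact: lift_is_additive. Qed.

HB.instance Definition _ :=
  GRing.isAdditive.Build _ _ freeg_ext freeg_ext_additive.

Lemma freeg_extU k s : freeg_ext << k *g s >> = f s *~ k.
Proof. by rewrite /freeg_ext liftU -scaler_int intz. Qed.

Lemma supp_ext (S : set K) (S' : set L) x : (forall s, S s -> supp S' (f s)) ->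
  supp S x -> supp S' (freeg_ext x).
Proof.
move=> hf hx; move: x hx; apply: supp_ind => [|k s x /hf hs IH].
  by rewrite raddf0; apply: supp0.
by rewrite raddfD /= freeg_extU; apply: suppD => //; apply: suppMz.
Qed.

End Linear.

(** * Cones and the boundary operator *)

Section Cone.
Local Open Scope ring_scope.
Context {d : Order.disp_t} {T : orderType d}.
Implicit Types (x y : {freeg (seq T) / int}) (s t : seq T) (g : T).

Definition cone g : {freeg (seq T) / int} -> {freeg (seq T) / int} :=
  freeg_ext (fun s => << rcons s g >>).

HB.instance Definition _ g := GRing.Additive.on (cone g).

Lemma coneU g k s : cone g << k *g s >> = << k *g rcons s g >>.
Proof. by rewrite /cone freeg_extU freegU_mulz intz. Qed.

(** Left inverse of the cone on generators: it extracts the coefficient of a final [g] and kills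
    tuples that do not end in [g]. Reversal exposes the last entry. *)
Definition uncone_gen g s : {freeg (seq T) / int} :=
  if rev s is y :: t then if y == g then << rev t >> else 0 else 0.

Definition uncone g : {freeg (seq T) / int} -> {freeg (seq T) / int} :=
  freeg_ext (uncone_gen g).

HB.instance Definition _ g := GRing.Additive.on (uncone g).

Lemma coneK g : cancel (cone g) (uncone g).
Proof.
move=> x; have hx : supp setT x by [].
move: x hx; apply: supp_ind => [|k s x _ IH]; first by rewrite !raddf0.
rewrite !raddfD /= IH coneU; congr +%R.
by rewrite /uncone freeg_extU /uncone_gen rev_rcons eqxx revK freegU_mulz intz.
Qed.

Lemma uncone0 g x : supp (fun s => g \notin s) x -> uncone g x = 0.
Proof.
move: x; apply: supp_ind => [|k s x gs IH]; first by rewrite raddf0.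
rewrite raddfD /= IH addr0 /uncone freeg_extU /uncone_gen.
case E: (rev s) => [|y t]; first by rewrite mul0rz.
case: eqP => [yg|_]; last by rewrite mul0rz.
by move: gs; rewrite -mem_rev E yg mem_head.
Qed.

Lemma supp_cone (S S' : set (seq T)) g x : (forall s, S s -> S' (rcons s g)) ->
  supp S x -> supp S' (cone g x).
Proof. by move=> hS; apply: supp_ext => s /hS; apply: suppU. Qed.

Lemma supp_cone_inv (S S' : set (seq T)) g x : supp S x ->
  (forall s, S s -> exists2 t, s = rcons t g & S' t) ->
  exists2 w, x = cone g w & supp S' w.
Proof.
move=> hx hS; move: x hx; apply: supp_ind => [|k s x /hS[t -> St] [w -> hw]].
  by exists 0; [rewrite raddf0|apply: supp0].
exists (<< k *g t >> + w); last by apply: suppD => //; apply: suppU.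
by rewrite raddfD /= coneU.
Qed.

Lemma boundaryU k s : boundary << k *g s >> = boundary_gen s *~ k.
Proof. by rewrite /boundary liftU -scaler_int intz. Qed.

Lemma boundary_gen_rcons s g : boundary_gen (rcons s g) =
  cone g (boundary_gen s) + << s >> *~ (-1) ^+ size s.
Proof.
rewrite /boundary_gen size_rcons big_ord_recr /= raddf_sum /=; congr +%R; last first.
  rewrite -cats1 takel_cat // take_size drop_oversize ?cats0 ?size_cat ?addn1 //.
  by rewrite freegU_mulz intz.
apply: eq_bigr => i _; rewrite coneU drop_rcons // -rcons_cat.
by rewrite -[X in take _ X]cats1 takel_cat // ltnW.
Qed.

(** The cone is a contracting homotopy up to sign, so a cycle is, up to sign, the boundary of its
    cone. This includes [n = 0]: the empty tuple is the boundary of every one-entry tuple. *)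
Lemma boundary_cone n g x : supp (fun s => size s = n) x ->
  boundary (cone g x) = cone g (boundary x) + x *~ (-1) ^+ n.
Proof.
move: x; apply: supp_ind => [|k s x sn IH]; first by rewrite !raddf0 mul0rz addr0.
rewrite !raddfD /= IH coneU !boundaryU boundary_gen_rcons mulrzDl sn raddfMz.
rewrite mulrzDl -addrA -[RHS]addrA; congr +%R; rewrite addrCA; congr (_ + (_ + _)).
have -> : << k *g s >> = << s >> *~ k by rewrite freegU_mulz intz.
by rewrite -!mulrzA mulrC.
Qed.

Lemma subseq_take_drop (i : nat) s : subseq (take i s ++ drop i.+1 s) s.
Proof.
elim: s i => [|x s IH] [|i] //; first by rewrite take0 drop1; apply: subseq_cons.
by rewrite /= eqxx.
Qed.

Lemma size_take_drop (i : nat) s : (i < size s)%N ->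
  size (take i s ++ drop i.+1 s) = (size s).-1.
Proof.
move=> lt; rewrite size_cat size_drop size_take lt.
by case: (size s) lt => //= m; rewrite ltnS => /subnKC.
Qed.

Lemma supp_boundary n (A : set T) x :
  supp (incr_tuple n.+1 A) x -> supp (incr_tuple n A) (boundary x).
Proof.
move: x; apply: supp_ind => [|k s x [sn so sA] IH]; first by rewrite raddf0; apply: supp0.
rewrite raddfD /= boundaryU; apply: suppD => //; apply: suppMz.
rewrite /boundary_gen; elim/big_ind: _ => [|y z|i _]; [exact: supp0|exact: suppD|].
have sub := subseq_take_drop i s.
apply: suppU; split.
- by rewrite size_take_drop // sn.
- exact: (subseq_sorted lt_trans sub so).
- by move=> y /(mem_subseq sub)/sA.
Qed.

Lemma boundary_gen_size s : supp (fun t => size t = (size s).-1) (boundary_gen s).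
Proof.
rewrite /boundary_gen; elim/big_ind: _ => [|y z|i _]; [exact: supp0|exact: suppD|].
by apply: suppU; apply: size_take_drop.
Qed.

Lemma boundary_boundary x : boundary (boundary x) = 0.
Proof.
have hx : supp setT x by [].
move: x hx; apply: supp_ind => [|k s x _ IH]; first by rewrite !raddf0.
rewrite !raddfD /= IH addr0 boundaryU raddfMz /=; suff -> : boundary (boundary_gen s) = 0.
  by rewrite mul0rz.
elim/last_ind: s => [|s g IHs].
  by rewrite /boundary_gen big_ord0 raddf0.
rewrite boundary_gen_rcons raddfD raddfMz /= boundaryU mulr1z.
rewrite (@boundary_cone (size s).-1) ?IHs; last exact: boundary_gen_size.
(* The two remaining terms have opposite signs unless [s] is empty, where both exponents are 0; but
   then the boundary of [s] vanishes. *)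
rewrite raddf0 add0r; case: (posnP (size s)) => [/size0nil->|s0].
  by rewrite /boundary_gen big_ord0 !mul0rz addr0.
by rewrite -[in X in _ + X](prednK s0) exprS mulN1r mulrNz subrr.
Qed.

End Cone.

(** * Splitting chains at a top vertex *)

Section Basis.
Local Open Scope classical_set_scope.
Local Open Scope ring_scope.
Local Open Scope order_scope.
Context {d : Order.disp_t} {T : orderType d}.
Hypothesis T_wo : well_order (@Order.le d T).
Implicit Types (a b g y : T) (A D : set T) (s t u : seq T) (C : T -> set T).
Implicit Types (x z w : {freeg (seq T) / int}).

Lemma incr_tuple_sub n A A' s : A `<=` A' -> incr_tuple n A s -> incr_tuple n A' s.
Proof. by move=> sub [sn so sA]; split=> // y /sA/sub. Qed.

Lemma sorted_rcons_lt s g :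
  sorted <%O (rcons s g) = all (< g) s && sorted <%O s.
Proof. by rewrite !(sorted_pairwise lt_trans) pairwise_rcons. Qed.

Lemma incr_rcons n A A' t g : A `<=` below g -> A `<=` A' -> A' g ->
  incr_tuple n A t -> incr_tuple n.+1 A' (rcons t g).
Proof.
move=> Ag AA' gA' [tn to tA]; split; first by rewrite size_rcons tn.
  by rewrite sorted_rcons_lt to andbT; apply/allP => y /tA/Ag.
by move=> y; rewrite mem_rcons inE => /orP[/eqP->//|/tA/AA'].
Qed.

Lemma incr_rcons_inv n A t g : incr_tuple n.+1 A (rcons t g) ->
  A g /\ incr_tuple n (A `&` below g) t.
Proof.
move=> [tn + tA]; rewrite sorted_rcons_lt => /andP[/allP tg to].
split; first by apply: tA; rewrite mem_rcons mem_head.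
split=> //; first by move: tn; rewrite size_rcons => -[].
by move=> y yt; split; [apply: tA; rewrite mem_rcons inE yt orbT|apply: tg].
Qed.

Lemma incr_size n A x : supp (incr_tuple n A) x -> supp (fun s => size s = n) x.
Proof. by apply: supp_sub => s []. Qed.

Lemma incr_notin n A g x : A `<=` below g -> supp (incr_tuple n A) x ->
  supp (fun s => g \notin s) x.
Proof.
by move=> Ag; apply: supp_sub => s [_ _ sA]; apply/negP => /sA/Ag; rewrite /below /= ltxx.
Qed.

(** In the boundary of [cone g w + z], the tuples ending in [g] form [cone g (boundary w)], and all
    others avoid [g]. Applying [uncone g] therefore isolates [boundary w]. *)
Lemma cycle_cone n g w z :
  supp (incr_tuple n (below g)) w -> supp (incr_tuple n.+1 (below g)) z ->
  boundary (cone g w + z) = 0 ->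
  boundary w = 0 /\ boundary z = - (w *~ (-1) ^+ n).
Proof.
move=> hw hz; rewrite raddfD /= (boundary_cone g (incr_size hw)) => E.
have dw : boundary w = 0.
  have := congr1 (uncone g) E; rewrite !raddfD raddf0 /= coneK.
  rewrite [X in _ + X + _](@uncone0 _ _ g); last by apply: suppMz; apply: incr_notin hw.
  rewrite [X in _ + X](@uncone0 _ _ g); first by rewrite !addr0.
  by apply: incr_notin (supp_boundary hz).
split=> //; move: E; rewrite dw raddf0 add0r => /eqP.
by rewrite addr_eq0 => /eqP->; rewrite opprK.
Qed.

(** Tuples are sorted by whether they end in [g]. The property [S] rides along: it is trivial in the
    spanning argument and [Bset C D] in the independence argument. *)
Lemma cone_split n A g x (S : set (seq T)) :
  (forall y, A y -> y <= g) ->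
  supp (fun s => incr_tuple n.+1 A s /\ S s) x ->
  exists w z, [/\ x = cone g w + z,
    supp (fun t => incr_tuple n (A `&` below g) t /\ S (rcons t g)) w &
    supp (fun s => incr_tuple n.+1 (A `&` below g) s /\ S s) z].
Proof.
move=> Ag hx.
have [s [hs Ss]|x1 [x2 [-> h1 h2]]] := supp_split (S1 := fun s => exists2 t, s = rcons t g &
    incr_tuple n (A `&` below g) t /\ S s)
  (S2 := fun s => incr_tuple n.+1 (A `&` below g) s /\ S s) hx.
  case/lastP: s hs Ss => [[]//|t y] hs Ss.
  have [Ay ht] := incr_rcons_inv hs.
  have [yg|yNg] := eqVneq y g; [left|right].
    by rewrite yg in ht Ss *; exists t.
  split=> //; have [sn so sA] := hs; split=> // q; rewrite mem_rcons inE => qt.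
  have lt_yg : y < g by rewrite lt_neqAle yNg Ag.
  case/orP: qt => [/eqP->|qt]; first by split.
  have [_ _ tA] := ht; have [Aq qy] := tA _ qt.
  by split=> //; apply: lt_trans lt_yg.
have [w -> hw] := supp_cone_inv
  (S' := fun t => incr_tuple n (A `&` below g) t /\ S (rcons t g)) h1
  (fun s => fun '(ex_intro2 t e h) => ex_intro2 _ _ t e (conj h.1 (eq_ind _ S h.2 _ e))).
by exists w, x2.
Qed.

Lemma Bset_last C D s y : Bset C D s -> D (last y s).
Proof. by case=> [D' u x g [[]]|D' t g]; rewrite last_rcons. Qed.

Lemma Bset_rconsP C D t g : Bset C D (rcons t g) ->
  (exists u y, t = rcons u y /\ is_next D y g) \/
  limit_point D g /\ Bset C (compound_step C D g) t.
Proof.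
move E: (rcons t g) => s Bs; case: Bs E => {D s} [D u y g' ng|D t' g' _ lg Bt].
  by move=> /rcons_inj[-> ->]; left; exists u, y.
by move=> /rcons_inj[-> ->]; right.
Qed.

Definition closed_itv a g : set T := [set y | a <= y /\ y <= g].

Lemma final_below a b : final_interval a b `<=` below b.
Proof. by move=> y []. Qed.

Lemma cofinal_bound n a b D z : cofinal_in b D ->
  supp (incr_tuple n.+1 (final_interval a b)) z ->
  z = 0 \/ exists2 g, D g & supp (incr_tuple n.+1 (closed_itv a g)) z.
Proof.
move=> [Db cD] hz; have [z0|zN0] := eqVneq z 0; [by left|right].
have [y0 y0b] : exists y, y < b.
  apply: contrapT => no; case/eqP: zN0; apply: (supp_false _ hz).
  move=> -[|y s] [] // _ _ /(_ y (mem_head _ _)) [_ yb].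
  by apply: no; exists y.
have bound (l : seq T) : (forall y, y \in l -> y < b) ->
    exists2 g, D g & forall y, y \in l -> y <= g.
  elim: l => [_|y l IH hl]; first by have [g Dg _] := cD _ y0b; exists g.
  have [|g Dg hg] := IH; first by move=> q ql; apply: hl; rewrite inE ql orbT.
  have [|g' Dg' le] := cD (Order.max g y).
    by rewrite gt_max (hl y) ?mem_head // andbT; apply: Db.
  move: le; rewrite ge_max => /andP[gg' yg'].
  exists g' => // q; rewrite inE => /orP[/eqP->//|/hg qg]; exact: le_trans gg'.
have [|g Dg hg] := bound (flatten (dom z)).
  by move=> y /flattenP[s /hz[_ _ sA] /sA[]].
exists g => // s sz; have [sn so sA] := hz _ sz; split=> // y ys.
split; first by have [] := sA _ ys.
by apply: hg; apply/flattenP; exists s.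
Qed.

(** * The generators span the cycles *)

Lemma span_cycles C n a b D z : nested_club C n b D ->
  supp (incr_tuple n (final_interval a b)) z -> boundary z = 0 ->
  exists2 x, supp (fun s => incr_tuple n.+1 (final_interval a b) s /\ Bset C D s) x
           & boundary x = z.
Proof.
elim: n b D z => [//|n IHn] b D z [[Db cD] clD lim].
have key g : D g -> forall z, supp (incr_tuple n.+1 (closed_itv a g)) z ->
    boundary z = 0 ->
    exists2 x, supp (fun s => incr_tuple n.+2 (closed_itv a g) s /\ Bset C D s) x
             & boundary x = z.
  elim/(lt_ind T_wo): g => g IH Dg {}z hz dz.
  have itvE : closed_itv a g `&` below g `<=` final_interval a g.
    by move=> y [[]].
  have sub g' : g' < g -> closed_itv a g' `<=` closed_itv a g.
    by move=> lt y [ay yg']; split=> //; apply: le_trans yg' (ltW lt).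
  have coneS m t : incr_tuple m.+1 (final_interval a g) t ->
      incr_tuple m.+2 (closed_itv a g) (rcons t g).
    move=> ht; apply: incr_rcons (ht); first exact: final_below.
      by move=> y [ay /ltW].
    split=> //; have [+ _ tA] := ht.
    case: t tA {ht} => // y t tA _.
    by have [ay /ltW] := tA _ (mem_head _ _); apply: le_trans.
  have [w [z' [zE hw' hz'']]] : exists w z', [/\ z = cone g w + z',
      supp (fun t => incr_tuple n (closed_itv a g `&` below g) t /\ True) w &
      supp (fun s => incr_tuple n.+1 (closed_itv a g `&` below g) s /\ True) z'].
    apply: (@cone_split n _ g z setT); first by move=> y [].
    by apply: supp_sub hz => s; split.
  have hw : supp (incr_tuple n (final_interval a g)) w.
    by apply: supp_sub hw' => s [hs _]; apply: incr_tuple_sub hs.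
  have hz' : supp (incr_tuple n.+1 (final_interval a g)) z'.
    by apply: supp_sub hz'' => s [hs _]; apply: incr_tuple_sub hs.
  have [dw dz'] : boundary w = 0 /\ boundary z' = - (w *~ (-1) ^+ n).
    apply: (@cycle_cone n g); last by rewrite -zE.
      by apply: supp_sub hw => s; apply: incr_tuple_sub; apply: final_below.
    by apply: supp_sub hz' => s; apply: incr_tuple_sub; apply: final_below.
  (* The part of a cycle away from [g] determines it: the coefficient [w] of [g] is, up to sign, the
     boundary of [z']. *)
  have zE' : z = boundary (cone g z') *~ (-1) ^+ n.+1.
    rewrite (boundary_cone g (incr_size hz')) dz' zE raddfN raddfMz /=.
    rewrite mulrzDl -!mulrzA -expr2 sqrr_sign mulr1z; congr (_ + _).
    by rewrite mulNrz -mulrzA exprS mulN1r mulrN -expr2 sqrr_sign mulrNz opprK.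
  case: (closed_cases T_wo clD Db Dg) => [lg|gmin|[g0 [Dg0 g0g g0max]]].
  (* Limit point: [w] is filled by some [x] in one dimension less, and subtracting the boundary of
     [cone g x] leaves a cycle strictly below [g], hence below some [g'] of [D] with [g' < g]. *)
  - have [x hx dx] := IHn _ _ _ (lim _ Dg lg) hw dw.
    have hcx : supp (fun s => incr_tuple n.+2 (closed_itv a g) s /\ Bset C D s) (cone g x).
      by apply: supp_cone hx => s [/coneS hs Bs]; split=> //; apply: Bset_limit.
    have hx1 : supp (incr_tuple n.+1 (final_interval a g)) x.
      by apply: supp_sub hx => s [].
    pose z1 := z' - x *~ (-1) ^+ n.+1.
    have z1E : z = boundary (cone g x) + z1.
      by rewrite (boundary_cone g (incr_size hx1)) dx zE /z1 addrACA subrr addr0.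
    have hz1 : supp (incr_tuple n.+1 (final_interval a g)) z1.
      by apply: suppB => //; apply: suppMz.
    have dz1 : boundary z1 = 0.
      by move: dz; rewrite z1E raddfD /= boundary_boundary add0r.
    have cg : cofinal_in g (D `&` below g).
      split=> [y []//|y yg]; have [_ /(_ _ yg)[q [Dq /ltW yq qg]]] := lg.
      by exists q.
    have [z10|[g' [Dg' g'g] hz1']] := cofinal_bound cg hz1.
      by exists (cone g x) => //; rewrite z1E z10 addr0.
    have [x1 hx1' dx1] := IH _ g'g Dg' _ hz1' dz1.
    exists (cone g x + x1); last by rewrite raddfD /= dx1 -z1E.
    apply: suppD => //; apply: supp_sub hx1' => s [hs Bs]; split=> //.
    by apply: incr_tuple_sub hs; apply: sub.
  (* First point of [D]: [g] is the next point of [D] after anything below it, so every cone with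
     vertex [g] consists of generators. *)
  - exists (cone g z' *~ (-1) ^+ n.+1); last by rewrite raddfMz /= -zE'.
    apply: suppMz; apply: supp_cone hz' => s hs; split; first exact: coneS.
    case/lastP: s hs => [[]//|u y] /incr_rcons_inv[[_ yg] _].
    by apply: Bset_next; split=> // q [/gmin].
  (* Successor of [g0]: tuples with last entry at least [g0] give generators once [g] is appended;
     the others lie entirely below [g0] and form [z2]. *)
  - have [s hs|z1 [z2 [z12 h1 h2]]] := supp_split
        (S1 := fun s => incr_tuple n.+1 (final_interval a g) s
        /\ Bset C D (rcons s g)) (S2 := incr_tuple n.+1 (final_interval a g0)) hz'.
      case/lastP: s hs => [[]//|u y] hs; have [[ay yg] hu] := incr_rcons_inv hs.
      have [g0y|yg0] := leP g0 y; [left|right].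
        split=> //; apply: Bset_next; split=> // q [Dq yq].
        rewrite leNgt; apply/negP => /(g0max _ Dq) qg0.
        by have := lt_le_trans yq qg0; rewrite ltNge g0y.
      apply: incr_rcons hu => [q []//|q [[aq _] qy]|]; last by split.
      by split=> //; apply: lt_trans yg0.
    have h2' : supp (incr_tuple n.+1 (closed_itv a g0)) (boundary (cone g0 z2)).
      apply: supp_boundary; apply: supp_cone h2 => s hs.
      apply: incr_rcons (hs) => [|q [aq /ltW]|]; [exact: final_below|by split|].
      split=> //; have [+ _ sA] := hs; case: s sA {hs} => // q s sA _.
      by have [aq /ltW] := sA _ (mem_head _ _); apply: le_trans.
    have [x2 hx2 dx2] := IH _ g0g Dg0 _ h2' (boundary_boundary _).
    have sub0 : final_interval a g0 `<=` final_interval a g.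
      by move=> q [aq qg0]; split=> //; apply: lt_trans g0g.
    have hc2 : supp (fun s => size s = n.+2) (cone g0 z2).
      by apply: supp_cone h2 => s [sn _ _]; rewrite size_rcons sn.
    (* Obtained by expanding the double boundary of the cone of [z2] over [g0] and then [g]. *)
    have E : boundary (cone g z2) =
        boundary (cone g (cone g0 (boundary z2))) *~ (-1) ^+ n + boundary (cone g0 z2).
      have := boundary_boundary (cone g (cone g0 z2)).
      rewrite (boundary_cone g hc2) (boundary_cone g0 (incr_size h2)).
      rewrite !raddfD !raddfMz /= => /(congr1 (fun v => v *~ (-1) ^+ n)).
      rewrite mul0rz !mulrzDl -!mulrzA => /eqP.
      rewrite [(-1) ^+ n.+2 * _](_ : _ = 1); last first.
        by rewrite !exprS !mulN1r opprK -expr2 sqrr_sign.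
      rewrite [(-1) ^+ n.+1 * _](_ : _ = -1); last first.
        by rewrite exprS mulN1r mulNr -expr2 sqrr_sign.
      rewrite mulrN1z mulr1z addrAC subr_eq0 => /eqP <-.
      by rewrite (boundary_cone g0 (incr_size h2)).
    exists ((cone g z1 + cone g (cone g0 (boundary z2)) *~ (-1) ^+ n + x2) *~ (-1) ^+ n.+1).
      apply: suppMz; apply: suppD; first apply: suppD.
      + by apply: supp_cone h1 => s [/coneS].
      (* For [n = 0] the tuples in [boundary z2] are empty and do not force [a <= g0]; when
         [g0 < a], however, [z2] is zero. *)
      + have [ag0|g0a] := leP a g0; last first.
          rewrite (supp_false _ h2) ?raddf0 ?mul0rz; first exact: supp0.
          move=> [|q s] [] // _ _ /(_ q (mem_head _ _))[aq qg0].
          by have := lt_trans (le_lt_trans aq qg0) g0a; rewrite ltxx.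
        apply: suppMz; have hb := supp_boundary h2.
        apply: (@supp_cone _ _ (fun s =>
          incr_tuple n.+1 (final_interval a g) s /\ exists u, s = rcons u g0)).
          move=> s [/coneS hs [u su]]; split=> //; rewrite su; apply: Bset_next.
          by split=> // q [Dq g0q];
            rewrite leNgt; apply/negP => /(g0max _ Dq); rewrite leNgt g0q.
        apply: supp_cone hb => s hs; split; last by exists s.
        by apply: incr_rcons hs => //; apply: final_below.
      + apply: supp_sub hx2 => s [hs Bs]; split=> //; by apply: incr_tuple_sub hs; apply: sub.
    by rewrite raddfMz /= zE' z12 !raddfD raddfMz /= E dx2 addrA.
move=> hz dz; have [->|[g Dg hz']] := cofinal_bound (conj Db cD) hz.
  by exists 0; [exact: supp0|rewrite raddf0].
have [x hx dx] := key g Dg _ hz' dz; exists x => //.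
apply: supp_sub hx => s [hs Bs]; split=> //; apply: incr_tuple_sub hs.
by move=> y [ay yg]; split=> //; apply: le_lt_trans yg _; apply: Db.
Qed.

(** * Independence of the boundaries of generators *)

Lemma last_bound C n b D x :
  supp (fun s => incr_tuple n.+1 (below b) s /\ Bset C D s) x ->
  x = 0 \/ exists g, [/\ D g, g < b &
    supp (fun s => incr_tuple n.+1 [set y | y <= g] s /\ Bset C D s) x].
Proof.
move=> hx; have [x0|xN0] := eqVneq x 0; [by left|right].
have lastP s : s \in dom x -> [/\ D (last b s), last b s < b &
    forall y, y \in s -> y <= last b s].
  move=> /hx[hs Bs]; split; first exact: Bset_last Bs.
    case/lastP: s hs {Bs} => [[]//|t y] /incr_rcons_inv[yb _].
    by rewrite last_rcons.
  case/lastP: s hs {Bs} => [[]//|t y] /incr_rcons_inv[_ [_ _ ty]] q.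
  by rewrite last_rcons mem_rcons inE => /orP[/eqP->//|/ty[_ /ltW]].
have bound (l : seq (seq T)) : {subset l <= dom x} -> l != [::] ->
    exists g, [/\ D g, g < b & forall s, s \in l -> last b s <= g].
  elim: l => // s l IH sub _; have [Ds sb _] := lastP s (sub s (mem_head _ _)).
  have [->|lN0] := eqVneq l [::].
    by exists (last b s); split=> // t; rewrite inE => /eqP->.
  have [|//|g [Dg gb hg]] := IH; first by move=> t tl; apply: sub; rewrite inE tl orbT.
  have [sg|gs] := leP (last b s) g.
    by exists g; split=> // t; rewrite inE => /orP[/eqP->|/hg].
  exists (last b s); split=> // t; rewrite inE => /orP[/eqP->//|/hg tg].
  exact: le_trans tg (ltW gs).
have [//||g [Dg gb hg]] := bound (dom x); first by rewrite dom_eq0.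
exists g; split=> // s sx; have [[sn so _] Bs] := hx _ sx; split=> //; split=> // y ys.
by have [_ _ /(_ _ ys) yl] := lastP _ sx; apply: le_trans yl (hg _ sx).
Qed.

(** For fixed [n], induction along [D] on a bound [g] of the support: once the coefficient [y] of
    [g] vanishes, the last entries of the remaining generators are points of [D] below [g], and
    [last_bound] provides a smaller bound in [D]. *)
Lemma Bset_independent C n b D x : nested_club C n b D ->
  supp (fun s => incr_tuple n.+1 (below b) s /\ Bset C D s) x ->
  boundary x = 0 -> x = 0.
Proof.
elim: n b D x => [//|n IHn] b D x [[Db cD] clD lim].
suff key g : D g -> forall x,
    supp (fun s => incr_tuple n.+2 [set y | y <= g] s /\ Bset C D s) x ->
    boundary x = 0 -> x = 0.
  by move=> hx dx; have [//|[g [Dg _ hx']]] := last_bound hx; apply: key Dg _ hx' dx.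
elim/(lt_ind T_wo): g => g IH Dg {}x hx dx.
have leg q : [set y | y <= g] q -> q <= g by [].
have [y [x' [xE hy' hx'']]] := @cone_split _ _ g x (Bset C D) leg hx.
have hy : supp (fun t => incr_tuple n.+1 (below g) t /\ Bset C D (rcons t g)) y.
  by apply: supp_sub hy' => s [hs Bs]; split=> //; apply: incr_tuple_sub hs => q [].
have hx' : supp (fun s => incr_tuple n.+2 (below g) s /\ Bset C D s) x'.
  by apply: supp_sub hx'' => s [hs Bs]; split=> //; apply: incr_tuple_sub hs => q [].
have hy1 : supp (incr_tuple n.+1 (below g)) y by apply: supp_sub hy => s [].
have [dy dx'] : boundary y = 0 /\ boundary x' = - (y *~ (-1) ^+ n.+1).
  apply: (@cycle_cone _ g) => //; last by rewrite -xE.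
  by apply: supp_sub hx' => s [].
have yE : y = - (boundary x' *~ (-1) ^+ n.+1).
  by rewrite dx' mulNrz opprK -mulrzA -expr2 sqrr_sign mulr1z.
suff y0 : y = 0.
  rewrite xE y0 raddf0 add0r in dx *.
  have [//|[g' [Dg' g'g hx1]]] := last_bound hx'.
  exact: IH g'g Dg' _ hx1 dx.
case: (closed_cases T_wo clD Db Dg) => [lg|gmin|[g0 [Dg0 g0g g0max]]].
(* A limit point of [D] is not the next point of [D] after anything, so [y] is a cycle made of
   generators for the compound club at [g]. *)
- apply: IHn (lim _ Dg lg) _ dy; apply: supp_sub hy => s [hs Bs]; split=> //.
  case/Bset_rconsP: Bs => [[u [q [_ [[_ qg] qmin]]]]|[]//].
  have [_ /(_ _ qg)[r [Dr qr rg]]] := lg.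
  by have := qmin r (conj Dr qr); rewrite leNgt rg.
- rewrite yE (supp_false _ hx') ?raddf0 ?mul0rz ?oppr0 // => s [hs Bs].
  have := gmin _ (Bset_last g Bs); case/lastP: s hs {Bs} => [[]//|t q] /incr_rcons_inv[qg _].
  by rewrite last_rcons leNgt qg.
(* The generators in [x'] end at or below [g0], hence so do the tuples of [y], a boundary of [x'] up
   to sign. Since [g] is the next point of [D] after their last entry, that entry is exactly [g0].
   Thus [y] is a cone over [g0], and a cone that is a cycle is zero. *)
- have hx1 : supp (incr_tuple n.+2 [set q | q <= g0]) x'.
    apply: supp_sub hx' => s [hs Bs]; have [sn so sg] := hs; split=> // q.
    have := Bset_last g Bs; case/lastP: s hs {Bs sn so sg} => [[]//|t r].
    move=> /incr_rcons_inv[rg [_ _ tr]]; rewrite last_rcons => Dr.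
    rewrite mem_rcons inE => /orP[/eqP->|/tr[_ /ltW qr]]; first exact: g0max.
    exact: le_trans qr (g0max _ Dr rg).
  have hy2 : supp (fun s => incr_tuple n.+1 [set q | q <= g0] s /\ Bset C D (rcons s g)) y.
    move=> s sy; split; last by have [] := hy _ sy.
    by move: s sy; rewrite yE; apply: suppN; apply: suppMz; apply: supp_boundary.
  have [s [hs Bs]|w ywE hw] := supp_cone_inv (g := g0)
      (S' := incr_tuple n (below g0)) hy2.
    case: (Bset_rconsP Bs) => [[u [q [sE [_ qmin]]]]|[[_ lg] _]]; last first.
      by have [r [Dr gr /(g0max _ Dr)]] := lg _ g0g; rewrite leNgt gr.
    rewrite sE in hs *; have [/= qg0 hu] := incr_rcons_inv hs.
    have qE : q = g0.
      apply: le_anti; rewrite qg0 leNgt; apply/negP => lt.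
      by have := qmin g0 (conj Dg0 lt); rewrite leNgt g0g.
    rewrite qE in hu *; exists u => //; apply: incr_tuple_sub hu => r [].
    by [].
  have [_] : boundary w = 0 /\ boundary (0 : {freeg (seq T) / int}) = - (w *~ (-1) ^+ n).
    by apply: (@cycle_cone _ g0) => //; [apply: supp0|rewrite addr0 -ywE].
  move=> /(congr1 (fun v => - (v *~ (-1) ^+ n))).
  rewrite raddf0 mul0rz oppr0 mulNrz opprK -mulrzA -expr2 sqrr_sign mulr1z => w0.
  by rewrite ywE -w0 raddf0.
Qed.

(** * Passage to the inverse system *)

Section Evaluation.
Variables (n : nat) (eps : T).

Definition above_val (a : seg eps) (p : above (dP n eps) a) : {freeg (seq T) / int} :=
  dP_val (tagged (val p)).

(** Bonding maps are inclusions, so the evaluation can be computed in the ambient free group. *)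
Lemma eval_aboveE (a : seg eps) (c : {freeg (above (dP n eps) a) / int}) :
  dP_val (eval_above c) = freeg_ext (@above_val a) c.
Proof.
pose v : {additive dP_term n eps (val a) -> {freeg (seq T) / int}} := \val.
rewrite -[LHS]/(v (eval_above c)) -[in RHS](freeg_sumE c) !raddf_sum /=.
by apply: eq_bigr => p _; rewrite freeg_extU; apply: (raddfMz v).
Qed.

(** Points of the total space carry an index besides their value; the head of [s] fixes that
    index. *)
Lemma above_val_inj (a : seg eps) (p p' : above (dP n eps) a) s :
  ohead s = Some (val (tag (val p))) -> above_val p = boundary << s >> ->
  ohead s = Some (val (tag (val p'))) -> above_val p' = boundary << s >> -> p = p'.
Proof.
rewrite /above_val; case: p => -[b x] h; case: p' => -[b' x'] h' /= -> xE [] /val_inj bb'.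
subst b' => x'E; apply: val_inj => /=; congr existT; apply: val_inj.
by rewrite /= xE x'E.
Qed.

Lemma dB_exists C D (a : seg eps) s : B_gen C n eps D s ->
  incr_tuple n.+1 (final_interval (val a) eps) s ->
  exists p : above (dP n eps) a, [/\ dB n eps C D (val p),
    ohead s = Some (val (tag (val p))) & above_val p = boundary << s >>].
Proof.
move=> Bs hs; have [sn so sA] := hs.
case: s sn so sA Bs hs => // y t sn so sA Bs hs.
have [ay yeps] := sA _ (mem_head _ _).
pose b : seg eps := exist _ y yeps.
have hb : boundary << y :: t >> \in dP_pred n eps (val b).
  apply/asboolP; exists << y :: t >> => // s; rewrite domU1 inE => /eqP->.
  split=> // q qt; split; last by have [] := sA _ qt.
  move: qt so; rewrite inE /= => /orP[/eqP->//|qt] /(order_path_min lt_trans)/allP.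
  by move=> /(_ _ qt)/ltW.
have ab : a <= b by [].
exists (exist _ (existT _ b (DPTerm hb)) ab); split=> //.
by exists (y :: t).
Qed.

(** The maps [r] and [q] translate between tuples and points of the total space. Existence of
    decompositions is [span_cycles]; uniqueness is [Bset_independent], applied to the tuples that
    [q] attaches to the difference of two decompositions. *)
Lemma dB_basis C D : C_sequence C -> admissible_club eps D -> nested_club C n eps D ->
  is_basis (dB n eps C D).
Proof.
move=> CC aD gD a x.
pose Ba (p : above (dP n eps) a) := dB n eps C D (val p).
pose Bs s := B_gen C n eps D s /\ incr_tuple n.+1 (final_interval (val a) eps) s.
have /choice[r rP] : forall s, exists p : above (dP n eps) a, Bs s ->
    [/\ Ba p, ohead s = Some (val (tag (val p))) & above_val p = boundary << s >>].
  move=> s; have [[Bgs hs]|nB] := pselect (Bs s).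
    by have [p hp] := dB_exists Bgs hs; exists p.
  by exists (exist _ (existT _ a (0%R : term (dP n eps) a)) (lexx a)).
have /choice[q qP] : forall p : above (dP n eps) a, exists s, Ba p ->
    [/\ Bs s, ohead s = Some (val (tag (val p))) & above_val p = boundary << s >>].
  move=> p; have [[s [Bgs sp pE]]|nB] := pselect (Ba p); last by exists [::].
  exists s => _; split=> //; split=> //.
  have /(B_genP T_wo _ _ CC aD)[[sn so sA] _] := Bgs; split=> // y ys; split; last exact: sA.
  have ap : val a <= val (tag (val p)) by exact: (valP p).
  apply: le_trans ap _.
  case: s sp so ys {Bgs pE sn sA} => //= h t [->]; rewrite inE.
  by move=> /(order_path_min lt_trans)/allP ht /orP[/eqP->//|/ht/ltW].
have dr z : supp Bs z ->
    freeg_ext (@above_val a) (freeg_ext (fun s => << r s >>) z) = boundary z.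
  move: z; apply: supp_ind => [|k s z hs IH]; first by rewrite !raddf0.
  rewrite !raddfD /= IH; congr (_ + _)%R; rewrite boundaryU freeg_extU raddfMz /=.
  by rewrite freeg_extU mulr1z; have [_ _ ->] := rP s hs; rewrite boundaryU mulr1z.
have dq c : supp Ba c ->
    boundary (freeg_ext (fun p => << q p >>) c) = freeg_ext (@above_val a) c.
  move: c; apply: supp_ind => [|k p c hp IH]; first by rewrite !raddf0.
  rewrite !raddfD /= IH; congr (_ + _)%R; rewrite !freeg_extU raddfMz /=.
  by have [_ _ ->] := qP p hp.
have rq c : supp Ba c ->
    freeg_ext (fun s => << r s >>) (freeg_ext (fun p => << q p >>) c) = c.
  move: c; apply: supp_ind => [|k p c hp IH]; first by rewrite !raddf0.
  rewrite !raddfD /= IH; congr (_ + _)%R; rewrite freeg_extU raddfMz /= freeg_extU mulr1z.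
  have [Bq hq vq] := qP p hp; have [_ hr vr] := rP _ Bq.
  by rewrite (above_val_inj hr vr hq vq) freegU_mulz intz.
have [z hz dz] : exists2 z, supp (fun s =>
    incr_tuple n.+1 (final_interval (val a) eps) s /\ Bset C D s) z &
    boundary z = dP_val x.
  case: x => x /= /asboolP[z hz <-]; apply: (span_cycles gD); last exact: boundary_boundary.
  exact: supp_boundary.
have hz' : supp Bs z.
  apply: supp_sub hz => s [hs BDs]; split=> //; apply/(B_genP T_wo _ _ CC aD); split=> //.
  by apply: incr_tuple_sub hs; apply: final_below.
have hr : supp Ba (freeg_ext (fun s => << r s >>) z).
  by apply: supp_ext hz' => s /rP[Br _ _]; apply: suppU.
exists (freeg_ext (fun s => << r s >>) z); split.
  by split=> //; apply: val_inj; rewrite /= eval_aboveE dr.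
move=> c [hc xE]; apply/eqP; rewrite -subr_eq0; apply/eqP.
set e := (_ - c)%R; have he : supp Ba e by apply: suppB.
rewrite -(rq e he); suff -> : freeg_ext (fun p => << q p >>) e = 0%R by rewrite raddf0.
apply: (Bset_independent gD).
  by apply: supp_ext he => p /qP[[Bq _] _ _]; apply: suppU; apply/(B_genP T_wo _ _ CC aD).
by rewrite dq // raddfB /= dr // dz xE eval_aboveE subrr.
Qed.

End Evaluation.
End Basis.

Theorem theorem4p6 (n : nat) (n_gt0 : (0 < n)%N)
    (d : Order.disp_t) (T : orderType d) (T_wo : well_order (@Order.le d T))
    (eps : T) (cf_eps : lt_aleph (cf eps) n) :
  (forall (C : T -> set T) (D : set T),
     C_sequence C -> admissible_club eps D -> is_basis (dB n eps C D)) /\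
  is_free (dP n eps).
Proof.
have basis (C : T -> set T) (D : set T) : C_sequence C -> admissible_club eps D ->
    is_basis (dB n eps C D).
  move=> CC aD; apply: (dB_basis T_wo CC aD).
  by apply: (admissible_nested_club T_wo CC aD cf_eps); left.
(* Freeness requires an actual choice of clubs, hence the existence of a C-sequence. *)
split=> //; have [C CC] := ex_C_sequence T_wo.
by exists (dB n eps C (C eps)); apply: basis => //; case: CC.
Qed.
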